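(* Let $n\ge 4$, let $\mathbb{K}$ be a field, and let $G$ be a finite simple graph on $[n]$ with no isolated vertices. Then the following are equivalent: (1) $S/I_c(G)$ is level. (2) $G$ is a complete graph, a tree or a disjoint union of edges.
   Context: $S=\mathbb{K}[x_1,\dots,x_n]$ is the standard graded polynomial ring and $[n]=\{1,\dots,n\}$. For a simple graph $G$ with vertex set $[n]$ and edge set $E(G)$, the complementary edge ideal is $I_c(G)=(x_1\cdots x_n/(x_ix_j) : \{i,j\}\in E(G))\subset S$. For a graded ideal $I$, $S/I$ is level if it is Cohen--Macaulay and the last step of the minimal graded free resolution of $S/I$ is pure, i.e. with $p$ the projective dimension of $S/I$, there is exactly one $j$ with $\beta_{p,j}(S/I)\neq 0$. A tree is a connected graph with no cycles. A graph is a disjoint union of edges if every connected component consists of a single edge and its two endpoints. *)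

(* Defs.v *)
From mathcomp Require Export all_boot all_order all_algebra.
From mathcomp Require Export mpoly.

Set Implicit Arguments.
Unset Strict Implicit.
Unset Printing Implicit Defensive.

Import GRing.Theory.
Local Open Scope ring_scope.

(** * Ideals of S = K[x_1, ..., x_n] and invariants of S/I *)

(* A general ideal is a Prop-valued predicate on S.  Prime ideals are boolean
   predicates, so as to use the library's [idealr_closed] (which includes
   properness) and [prime_idealr_closed]; classically this is no restriction. *)

Definition ideal_gen (n : nat) (K : fieldType) (gs : seq {mpoly K[n]})
    (f : {mpoly K[n]}) : Prop :=
  exists c : nat -> {mpoly K[n]}, f = \sum_(i < size gs) c i * gs`_i.

Definition ideal_plus (n : nat) (K : fieldType) (I : {mpoly K[n]} -> Prop)
    (gs : seq {mpoly K[n]}) (f : {mpoly K[n]}) : Prop :=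
  exists u v, [/\ I u, ideal_gen gs v & f = u + v].

(* There is a chain P_0 < P_1 < ... < P_d of primes containing I; the values
   P k for k > d are irrelevant. *)
Definition prime_chain (n : nat) (K : fieldType) (I : {mpoly K[n]} -> Prop)
    (d : nat) : Prop :=
  exists P : nat -> {pred {mpoly K[n]}},
    (forall k, (k <= d)%N ->
       [/\ idealr_closed (P k), prime_idealr_closed (P k)
         & forall f, I f -> f \in P k]) /\
    (forall k, (k < d)%N ->
       {subset P k <= P k.+1} /\ ~ {subset P k.+1 <= P k}).

Definition krull_dim (n : nat) (K : fieldType) (I : {mpoly K[n]} -> Prop)
    (d : nat) : Prop :=
  prime_chain I d /\ (forall d', prime_chain I d' -> (d' <= d)%N).

(* As usual over a standard graded ring, S/I-sequences consist of homogeneous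
   elements of the maximal ideal (x_1, ..., x_n). *)
Definition regular_seq (n : nat) (K : fieldType) (I : {mpoly K[n]} -> Prop)
    (fs : seq {mpoly K[n]}) : Prop :=
  [/\ forall f, f \in fs -> exists2 k : nat, (0 < k)%N & f \is k.-homog,
      forall k, (k < size fs)%N -> forall h,
        ideal_plus I (take k fs) (fs`_k * h) -> ideal_plus I (take k fs) h
    & ~ ideal_plus I fs 1].

Definition depth (n : nat) (K : fieldType) (I : {mpoly K[n]} -> Prop)
    (d : nat) : Prop :=
  (exists2 fs, regular_seq I fs & size fs = d) /\
  (forall fs, regular_seq I fs -> (size fs <= d)%N).

Definition cohen_macaulay (n : nat) (K : fieldType)
    (I : {mpoly K[n]} -> Prop) : Prop :=
  exists2 d, krull_dim I d & depth I d.

(** * Graded free resolutions *)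

(* The data of graded maps ... -> F_2 -> F_1 -> F_0 -> S/I, where
   F_i = \bigoplus_(a < rk i) S(- deg i a), i.e. the a-th basis element of F_i
   has degree deg i a.  Matrices act on row vectors from the right; the map
   F_{i+1} -> F_i is [diff i] and F_0 -> S/I is [aug] followed by reduction
   modulo I.  As S/I lives in nonnegative degrees, the generators of its minimal
   resolution have nonnegative degrees, so shifts in nat suffice. *)
Record graded_maps (n : nat) (K : fieldType) := GradedMaps {
  rk : nat -> nat;
  deg : forall i, 'I_(rk i) -> nat;
  diff : forall i, 'M[{mpoly K[n]}]_(rk i.+1, rk i);
  aug : 'cV[{mpoly K[n]}]_(rk 0)
}.

Definition degree_preserving (n : nat) (K : fieldType)
    (F : graded_maps n K) : Prop :=
  (forall a, aug F a 0 \is (@deg n K F 0 a).-homog) /\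
  (forall i a b, diff F i a b != 0 ->
     (deg b <= deg a)%N /\ diff F i a b \is (deg a - deg b).-homog).

Definition exact_resolution (n : nat) (K : fieldType) (I : {mpoly K[n]} -> Prop)
    (F : graded_maps n K) : Prop :=
  [/\ exists u : 'rV_(rk F 0), I (1 - (u *m aug F) 0 0),
      forall u : 'rV_(rk F 0),
        I ((u *m aug F) 0 0) <-> exists v, u = v *m diff F 0
    & forall i (u : 'rV_(rk F i.+1)),
        u *m diff F i = 0 <-> exists v, u = v *m diff F i.+1].

(* F_{i+1} is mapped into (x_1, ..., x_n) F_i. *)
Definition is_minimal (n : nat) (K : fieldType) (F : graded_maps n K) : Prop :=
  forall i a b, (diff F i a b)@_0%MM = 0.

Definition minimal_graded_free_resolution (n : nat) (K : fieldType)
    (I : {mpoly K[n]} -> Prop) (F : graded_maps n K) : Prop :=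
  [/\ degree_preserving F, exact_resolution I F & is_minimal F].

Definition betti (n : nat) (K : fieldType) (F : graded_maps n K)
    (i j : nat) : nat :=
  #|[set a : 'I_(rk F i) | deg a == j]|.

(* For a minimal graded free resolution F of S/I this is the projective
   dimension of S/I. *)
Definition last_step (n : nat) (K : fieldType) (F : graded_maps n K)
    (p : nat) : Prop :=
  rk F p <> 0%N /\ forall q, (p < q)%N -> rk F q = 0%N.

(* The minimal graded free resolution is unique up to isomorphism, so it does
   not matter which one is chosen. *)
Definition is_level (n : nat) (K : fieldType) (I : {mpoly K[n]} -> Prop) : Prop :=
  cohen_macaulay I /\
  exists F : graded_maps n K,
    minimal_graded_free_resolution I F /\
    exists2 p, last_step F p & exists! j, betti F p j <> 0%N.

(** * Graphs on the vertex set 'I_n, given by their adjacency relation *)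

Definition complementary_edge_ideal (n : nat) (K : fieldType) (e : rel 'I_n) :
    {mpoly K[n]} -> Prop :=
  ideal_gen [seq \prod_(k < n | (k != ij.1) && (k != ij.2)) 'X_k
            | ij <- enum [pred ij : 'I_n * 'I_n | e ij.1 ij.2]].

Arguments complementary_edge_ideal {n} K e f.

Definition is_complete (n : nat) (e : rel 'I_n) : Prop :=
  forall i j, i != j -> e i j.

Definition is_tree (n : nat) (e : rel 'I_n) : Prop :=
  (forall i j, connect e i j) /\
  (forall c, ucycle e c -> ~ (2 < size c)%N).

Definition is_disjoint_union_of_edges (n : nat) (e : rel 'I_n) : Prop :=
  forall i, exists2 j, e i j & forall k, connect e i k = (k \in [:: i; j]).

(* Main.v *)
From HB Require Import structures.
Require Import Defs.
From mathcomp Require Import zify ring.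
From Stdlib Require Import ClassicalEpsilon FunctionalExtensionality PropExtensionality.

Set Implicit Arguments.
Unset Strict Implicit.
Unset Printing Implicit Defensive.

Import GRing.Theory.
Local Open Scope ring_scope.

(** Write x_W for the product of the variables with index in W, I for the
    complementary edge ideal of G and m for (x_1, ..., x_n).

    From the graph to levelness.  Build G up step by step inside [n]; when W
    grows, the ideal of the graph on W changes by a basic double link
    I' = q I + B, where B is contained in I and q is regular modulo B.  Then
    (I' : q) = I and I' + (q) = B + (q), that is, there is an exact sequence
    0 -> S/I(-deg q) -> S/I' -> S/(B + (q)) -> 0.  It transports two things.
    - Regular sequences ([wreg_link]).  The sequence is e_d, ..., e_1, the
      elementary symmetric polynomials, which works over every field: modulo
      (x_i : i in C) with |C| = n - d, the polynomial e_d is the product of the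
      remaining variables, and one link per factor of that product reduces
      e_{d-1}, ..., e_1 to larger sets C ([wreg_vars]).
    - Minimal resolutions, by a mapping cone ([short_res_cone]).
    A graph without cycles is built by attaching a new vertex to one old vertex
    (q is a variable, B = (x_{W - w})) or by adding a new component that is an
    edge uv (q = x_u x_v, B = (x_W)), see [forest_ind].  Each such step creates
    one syzygy, of degree |W| - 1 in the first case and |W| in the second, for
    the new W.  So S/I has a resolution of length 2 whose last step has a
    generator of degree n - 1 iff some vertex has two neighbours, and one of
    degree n iff G is disconnected ([forest_data]): the last step is pure
    exactly for trees and for disjoint unions of edges.  For a complete graph, B
    is the ideal of all x_{W - w}, which is built by links in the same way; the
    resolution has length 3 and its last step lives in degree n
    ([complete_resolution]).

    Dimension and depth are bounded above by one argument.  If I contains all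
    squarefree monomials in more than d variables, counting monomials shows that
    any d + 1 polynomials are algebraically dependent modulo I ([dependence]).
    Read from its lowest term, such a relation can be cancelled step by step
    along a chain of primes as well as along a regular sequence ([collapse]).

    From levelness to the graph.  If G is not complete, a missing edge gives a
    chain of monomial primes of length n - 2, so Cohen-Macaulayness yields a
    regular sequence of length at least n - 2 on S/I.  A regular element of m turns a
    nonzero class in the i-th Koszul homology of S/J into one in the (i+1)-st
    for S/(J + (f)) ([koszul_class_step]); as there is no Koszul homology above
    degree n, this forces H_3(x; S/I) = 0.  But a cycle of G, filled by a fan of
    triangles, is a nonzero class there ([cycle_koszul_class]).  Hence G is a
    forest, and since the degrees in a minimal resolution do not depend on the
    resolution ([resolution_degrees]), purity excludes that G has both a vertex
    with two neighbours and two components. *)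

(** * Ideals, weakly regular sequences and basic double links *)

Section Ideals.
Variables (n : nat) (K : fieldType).
Local Notation S := {mpoly K[n]}.
Implicit Types (Q J : S -> Prop) (f g h q : S).

Inductive ideal_of Q : S -> Prop :=
| ideal_of0 : ideal_of Q 0
| ideal_of_add f c g : ideal_of Q f -> Q g -> ideal_of Q (f + c * g).

(** The unit ideal is included: it arises below as a colon ideal. *)
Definition ideal_like J :=
  [/\ J 0, forall f g, J f -> J g -> J (f + g) & forall c f, J f -> J (c * f)].

Lemma ideal_of_mem Q g : Q g -> ideal_of Q g.
Proof.
by move=> Qg; rewrite -[g]mul1r -[_ * _]add0r; apply: ideal_of_add => //; left.
Qed.

Lemma ideal_of_ideal Q : ideal_like (ideal_of Q).
Proof.
split; first by left.
- move=> f g If; elim=> [|g' c h _ IH Qh]; first by rewrite addr0.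
  by rewrite addrA; apply: ideal_of_add.
- move=> c f; elim=> [|g d h _ IH Qh]; first by rewrite mulr0; left.
  by rewrite mulrDr mulrA; apply: ideal_of_add.
Qed.

Lemma ideal_of_min Q J f :
  ideal_like J -> (forall g, Q g -> J g) -> ideal_of Q f -> J f.
Proof.
case=> J0 JD JM QJ; elim=> // g c h _ Jg Qh.
by apply: JD => //; apply: JM; apply: QJ.
Qed.

Lemma ideal_of_sub Q Q' f :
  (forall g, Q g -> ideal_of Q' g) -> ideal_of Q f -> ideal_of Q' f.
Proof. by apply: ideal_of_min; apply: ideal_of_ideal. Qed.

Section IdealTheory.
Variable J : S -> Prop.
Hypothesis idJ : ideal_like J.

Lemma ideal_like0 : J 0. Proof. by case: idJ. Qed.
Lemma ideal_likeD f g : J f -> J g -> J (f + g).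
Proof. by case: idJ => _ + _; apply. Qed.
Lemma ideal_likeM c f : J f -> J (c * f).
Proof. by case: idJ => _ _; apply. Qed.
Lemma ideal_likeMr c f : J f -> J (f * c).
Proof. by rewrite mulrC; apply: ideal_likeM. Qed.
Lemma ideal_likeN f : J f -> J (- f).
Proof. by rewrite -mulN1r; apply: ideal_likeM. Qed.
Lemma ideal_likeB f g : J f -> J g -> J (f - g).
Proof. by move=> Jf /ideal_likeN; apply: ideal_likeD. Qed.
Lemma ideal_likeDr f g : J f -> J (f + g) -> J g.
Proof. by move=> Jf /ideal_likeB/(_ Jf); rewrite addrC addKr. Qed.
Lemma ideal_like_sum (I : Type) (r : seq I) (P : pred I) (F : I -> S) :
  (forall i, P i -> J (F i)) -> J (\sum_(i <- r | P i) F i).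
Proof. by move=> JF; apply: big_ind => //; [case: idJ | apply: ideal_likeD]. Qed.

End IdealTheory.

(** The ideal J + (f). *)
Definition adjoin J f : S -> Prop := fun h => exists a c, J a /\ h = a + c * f.

Lemma adjoin_ideal J f : ideal_like J -> ideal_like (adjoin J f).
Proof.
move=> idJ; split.
- by exists 0, 0; rewrite mul0r addr0; split=> //; apply: ideal_like0.
- move=> _ _ [a [c [Ja ->]]] [b [d [Jb ->]]]; exists (a + b), (c + d); split.
    exact: ideal_likeD.
  by rewrite mulrDl addrACA.
- move=> x _ [a [c [Ja ->]]]; exists (x * a), (x * c).
  by split; [apply: ideal_likeM | rewrite mulrDr mulrA].
Qed.

Lemma adjoin_sub J f h : J h -> adjoin J f h.
Proof. by move=> Jh; exists h, 0; rewrite mul0r addr0. Qed.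

Lemma adjoin_mem J f : ideal_like J -> adjoin J f f.
Proof.
by move=> idJ; exists 0, 1; rewrite mul1r add0r; split=> //; apply: ideal_like0.
Qed.

Lemma adjoin_min J J' f h :
  ideal_like J' -> (forall a, J a -> J' a) -> J' f -> adjoin J f h -> J' h.
Proof.
by move=> idJ' sJ Jf [a [c [/sJ Ja ->]]]; apply: ideal_likeD => //; apply: ideal_likeM.
Qed.

Definition regular_mod J f := forall h, J (f * h) -> J h.

(** Weakly regular sequences: S/(J + (fs)) may be zero, so that the unit ideal
    can serve as the end of an induction. *)
Fixpoint wreg J (fs : seq S) : Prop :=
  if fs is f :: fs' then regular_mod J f /\ wreg (adjoin J f) fs' else True.

Lemma wreg_ext J J' fs : (forall h, J h <-> J' h) -> wreg J fs -> wreg J' fs.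
Proof.
elim: fs J J' => //= f fs IH J J' eqJ [rf wf]; split.
  by move=> h /eqJ/rf/eqJ.
by apply: IH wf => h; split=> -[a [c [/eqJ Ja ->]]]; exists a, c.
Qed.

Lemma wreg_unit J fs : ideal_like J -> J 1 -> wreg J fs.
Proof.
have J1 J' : ideal_like J' -> J' 1 -> forall h, J' h.
  by move=> idJ' + h => /(ideal_likeMr idJ' h); rewrite mul1r.
elim: fs J => //= f fs IH J idJ JJ; split; first by move=> h _; apply: J1.
by apply: IH; [apply: adjoin_ideal | apply: adjoin_sub].
Qed.

(** Regularity passes along 0 -> S/(J : q) -> S/J -> S/(J + (q)) -> 0.  The
    induction goes through because, f being regular on both ends, the colon and
    the sum commute with adding f to J. *)
Lemma wreg_cut q J J1 J2 fs :
  ideal_like J ->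
  (forall h, J1 h <-> J (q * h)) -> (forall h, J2 h <-> adjoin J q h) ->
  wreg J1 fs -> wreg J2 fs -> wreg J fs.
Proof.
elim: fs J J1 J2 => //= f fs IH J J1 J2 idJ eq1 eq2 [r1 w1] [r2 w2]; split.
  move=> h Jfh.
  have /r2/eq2 [a [c [Ja eh]]] : J2 (f * h).
    by apply/eq2; apply: adjoin_sub.
  rewrite eh in Jfh *; apply: ideal_likeD => //; rewrite mulrC.
  apply/eq1/r1/eq1; apply: (ideal_likeDr idJ (f := f * a)).
    exact: ideal_likeM.
  by move: Jfh; rewrite mulrDr (mulrC c) (mulrCA f).
apply: (IH _ _ _ (adjoin_ideal _ idJ) _ _ w1 w2) => h.
  split=> [[a [c [/eq1 Ja ->]]]|[a [c [Ja eh]]]].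
    by exists (q * a), (q * c); rewrite mulrDr mulrA.
  have /r2/eq2 [b [d [Jb ec]]] : J2 (f * c).
    apply/eq2; exists (- a), h; split; first exact: ideal_likeN.
    by rewrite (mulrC h) eh addKr mulrC.
  exists (h - d * f), d; split; last by rewrite subrK.
  apply/eq1; rewrite mulrBr eh ec mulrDl.
  have -> : q * (d * f) = d * q * f by rewrite mulrCA mulrA.
  rewrite addrA addrK.
  by apply: ideal_likeD => //; apply: ideal_likeMr.
split.
  move=> [a [c [/eq2 [b [d [Jb ->]]] ->]]].
  exists (b + c * f), d; split; first by exists b, c.
  by rewrite addrAC.
move=> [_ [d [[b [c [Jb ->]]] ->]]].
exists (b + d * q), c; split; first by apply/eq2; exists b, d.
by rewrite addrAC.
Qed.

(** Generators of the basic double link q (Q1) + (Q2). *)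
Definition link q Q1 Q2 : S -> Prop :=
  fun f => (exists2 g, Q1 g & f = q * g) \/ Q2 f.

Lemma ideal_of_link q Q1 Q2 f :
  ideal_of (link q Q1 Q2) f <->
  exists a b, [/\ ideal_of Q1 a, ideal_of Q2 b & f = q * a + b].
Proof.
have id1 := ideal_of_ideal Q1; have id2 := ideal_of_ideal Q2.
have idl := ideal_of_ideal (link q Q1 Q2).
split=> [|[a [b [Ia Ib ->]]]].
  elim=> [|f' c g _ [a [b [Ia Ib ->]]] [[h Qh ->]|Qg]].
  - by exists 0, 0; rewrite mulr0 addr0; split=> //; left.
  - exists (a + c * h), b; split=> //.
      by apply: ideal_of_add.
    by rewrite mulrDr addrAC mulrCA.
  - exists a, (b + c * g); split; rewrite ?addrA //.
    by apply: ideal_of_add.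
apply: ideal_likeD => //.
  elim: Ia => [|f' c g _ IH Qg]; first by rewrite mulr0; left.
  rewrite mulrDr; apply: ideal_likeD => //; rewrite mulrCA; apply: ideal_likeM => //.
  by apply: ideal_of_mem; left; exists g.
by apply: ideal_of_sub Ib => g Qg; apply: ideal_of_mem; right.
Qed.

Section Link.
Variables (q : S) (Q1 Q2 : S -> Prop).
Hypotheses (q_reg : regular_mod (ideal_of Q2) q)
           (Q21 : forall g, Q2 g -> ideal_of Q1 g).

(** If q h = q a + b, then q (h - a) = b lies in (Q2), so h - a does. *)
Lemma link_colon h : ideal_of Q1 h <-> ideal_of (link q Q1 Q2) (q * h).
Proof.
split=> [Ih|].
  apply/ideal_of_link; exists h, 0; rewrite addr0; split=> //; left.
move=> /ideal_of_link [a [b [Ia Ib e]]].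
have : ideal_of Q1 (h - a).
  by apply/(ideal_of_sub Q21)/q_reg; rewrite mulrBr e addrC addKr.
by move=> /(ideal_likeD (ideal_of_ideal Q1))/(_ Ia); rewrite subrK.
Qed.

Lemma link_adjoin h :
  adjoin (ideal_of Q2) q h <-> adjoin (ideal_of (link q Q1 Q2)) q h.
Proof.
split.
  move=> [a [c [Ia ->]]]; exists a, c; split=> //.
  by apply/ideal_of_link; exists 0, a; rewrite mulr0 add0r; split=> //; left.
move=> [_ [c [/ideal_of_link [a [b [Ia Ib ->]]] ->]]].
exists b, (a + c); split=> //.
by rewrite addrAC mulrDl addrC (mulrC q).
Qed.

Lemma wreg_link fs :
  wreg (ideal_of Q1) fs -> wreg (adjoin (ideal_of Q2) q) fs ->
  wreg (ideal_of (link q Q1 Q2)) fs.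
Proof.
exact: (wreg_cut (ideal_of_ideal _) link_colon link_adjoin).
Qed.

End Link.

Lemma adjoin_ideal_of Q q h :
  adjoin (ideal_of Q) q h <-> ideal_of (fun g => g = q \/ Q g) h.
Proof.
set Q' := fun g => _.
have sub f : ideal_of Q f -> ideal_of Q' f.
  by apply: ideal_of_sub => g Qg; apply: ideal_of_mem; right.
split=> [[a [c [Ia ->]]]|].
  by apply: ideal_of_add; [apply: sub | left].
apply: ideal_of_min; first exact/adjoin_ideal/ideal_of_ideal.
move=> g [->|Qg]; first exact/adjoin_mem/ideal_of_ideal.
by apply/adjoin_sub/ideal_of_mem.
Qed.

Lemma ideal_of_ext Q Q' f :
  (forall g, Q g -> ideal_of Q' g) -> (forall g, Q' g -> ideal_of Q g) ->
  ideal_of Q f <-> ideal_of Q' f.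
Proof. by move=> s1 s2; split; apply: ideal_of_sub. Qed.

Lemma ideal_of_iff Q Q' f : (forall g, Q g <-> Q' g) -> ideal_of Q f <-> ideal_of Q' f.
Proof. by move=> eqQ; apply: ideal_of_ext => g /eqQ; apply: ideal_of_mem. Qed.

Lemma wreg_iff Q Q' fs : (forall g, Q g <-> Q' g) ->
  wreg (ideal_of Q) fs -> wreg (ideal_of Q') fs.
Proof. by move=> eqQ; apply: wreg_ext => h; apply: ideal_of_iff. Qed.

End Ideals.

(** * Monomial primes and elementary symmetric polynomials *)

Section Monomials.
Variables (n : nat) (K : fieldType).
Local Notation S := {mpoly K[n]}.
Implicit Types (Q J : S -> Prop) (f g h q : S) (C U W : {set 'I_n}) (i : 'I_n).

(** The substitution x_i = 0 for i in C; its kernel is the prime (x_i : i in C). *)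
Definition kill C : S -> S :=
  mmap (@mpolyC n K) (fun i => if i \in C then 0 else 'X_i).

HB.instance Definition _ C := GRing.RMorphism.on (kill C).

Definition vars C : S -> Prop := fun g => exists2 i, i \in C & g = 'X_i.

Definition mono W : S := \prod_(i in W) 'X_i.

Lemma killX C i : kill C 'X_i = if i \in C then 0 else 'X_i.
Proof. by rewrite /kill mmapX mmap1U. Qed.

Lemma killC C c : kill C c%:MP = c%:MP.
Proof. exact: mmapC. Qed.

Lemma kill_mono C W : [disjoint C & W] -> kill C (mono W) = mono W.
Proof.
move=> dCW; rewrite rmorph_prod; apply: eq_bigr => i iW /=.
by rewrite killX (disjointFl dCW).
Qed.

Lemma kill_mono0 C W i : i \in C -> i \in W -> kill C (mono W) = 0.
Proof. by move=> iC iW; rewrite rmorph_prod (bigD1 i) //= killX iC mul0r. Qed.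

(** For a monomial, the factors are substituted one at a time. *)
Lemma sub_kill C f : ideal_of (vars C) (f - kill C f).
Proof.
have idC := ideal_of_ideal (vars C).
elim/mpolyind: f => [|c m f _ _ IH]; first by rewrite rmorph0 subr0; left.
rewrite rmorphD opprD addrACA; apply: ideal_likeD => //.
rewrite -mul_mpolyC rmorphM /= killC -mulrBr; apply: ideal_likeM => //.
rewrite mpolyXE_id rmorph_prod /=.
elim: (index_enum _) => [|i r IHr]; first by rewrite !big_nil subrr; left.
rewrite !big_cons.
set a := 'X_i ^+ _; set b := (X in _ * X - _); set b' := (X in _ - _ * X).
have -> : a * b - kill C a * b' = b * (a - kill C a) + kill C a * (b - b').
  by rewrite !mulrBr !(mulrC b) addrA subrK.
apply: ideal_likeD => //; apply: ideal_likeM => //.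
rewrite {}/a rmorphXn /= killX.
case: ifP => iC; last by rewrite subrr; left.
case: (m i) => [|k]; first by rewrite !expr0 subrr; left.
rewrite [0 ^+ _]expr0n /= subr0 exprSr; apply: ideal_likeM => //.
by apply: ideal_of_mem; exists i.
Qed.

Lemma vars1 i f : ideal_of (vars [set i]) f -> exists g, f = 'X_i * g.
Proof.
apply: (@ideal_of_min _ _ _ (fun f => exists g, f = 'X_i * g)).
  split; first by exists 0; rewrite mulr0.
  - by move=> _ _ [g ->] [h ->]; exists (g + h); rewrite mulrDr.
  - by move=> c _ [g ->]; exists (c * g); rewrite mulrCA.
by move=> _ [j /set1P -> ->]; exists 1; rewrite mulr1.
Qed.

Lemma mpolyX_neq0 i : 'X_i != 0 :> S.
Proof. by rewrite -msize_poly_eq0 msizeX. Qed.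

(** The substitution x_i = 0 fixes the generators, hence for f in (Q) the
    difference of f and its image is x_i b with b in (Q), not merely b in S. *)
Lemma regular_var Q i :
  (forall g, Q g -> kill [set i] g = g) -> regular_mod (ideal_of Q) 'X_i.
Proof.
move=> kQ h Ih.
suff [b Ib e] : exists2 b, ideal_of Q b & 'X_i * h - kill [set i] ('X_i * h) = 'X_i * b.
  move: e; rewrite rmorphM /= killX set11 mul0r subr0 => /(mulfI (mpolyX_neq0 i)).
  by move=> ->.
elim: Ih => [|f c g _ [b Ib e] Qg]; first by exists 0; [left | rewrite rmorph0 mulr0 subr0].
have [d ed] := vars1 (sub_kill [set i] c).
exists (b + d * g); first exact: ideal_of_add.
by rewrite rmorphD rmorphM /= (kQ g) // opprD addrACA e -mulrBl ed mulrDr mulrA.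
Qed.

(** The sequence e_d, ..., e_1. *)
Definition esyms d : seq S := [seq mesym n K k | k <- rev (iota 1 d)].

Lemma esymsS d : esyms d.+1 = mesym n K d.+1 :: esyms d.
Proof. by rewrite /esyms -[d.+1]addn1 iotaD rev_cat /= add1n addn1. Qed.

(** Of the monomials of e_d only the product over the complement of C avoids all
    x_i with i in C. *)
Lemma mesym_mod_vars C d : (#|C| + d = n)%N ->
  ideal_of (vars C) (mesym n K d - mono (~: C)).
Proof.
move=> cC; have idC := ideal_of_ideal (vars C).
have cCC : #|~: C| = d by rewrite cardsCs setCK card_ord; apply: (canLR (addKn _)).
rewrite /mesym (bigD1 (~: C)) /= ?cCC // addrC addrK.
apply: ideal_like_sum => // h /andP[ch nh].
have /subsetPn[i ih] : ~~ (h \subset ~: C).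
  apply: contra nh => hC; rewrite eqEcard hC cCC; exact: eq_leq (esym (eqP ch)).
rewrite inE negbK => iC; rewrite (bigD1 i) //= mulrC.
by apply: ideal_likeM => //; apply: ideal_of_mem; exists i.
Qed.

Lemma regular_mod_mono Q W :
  (forall i, i \in W -> regular_mod (ideal_of Q) 'X_i) ->
  regular_mod (ideal_of Q) (mono W).
Proof.
move=> rW; rewrite /mono; apply: big_ind => //.
- by move=> h; rewrite mul1r.
- by move=> a b ra rb h; rewrite -mulrA => /ra/rb.
Qed.

Lemma kill_vars C i g : i \notin C -> vars C g -> kill [set i] g = g.
Proof.
move=> iC [j jC ->]; rewrite killX inE; case: eqP => // ij.
by rewrite -ij jC in iC.
Qed.

Definition or_vars Q C : S -> Prop := fun g => Q g \/ vars C g.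

Lemma mono_setD1 U i : i \in U -> mono U = 'X_i * mono (U :\ i).
Proof. by move=> iU; rewrite /mono (big_setD1 i). Qed.

Lemma adjoin_or_vars Q C v h :
  adjoin (ideal_of (or_vars Q C)) 'X_v h <-> ideal_of (or_vars Q (v |: C)) h.
Proof.
apply: iff_trans (adjoin_ideal_of _ _ _) _; apply: ideal_of_iff => g; split.
  by move=> [->|[Qg|[i iC ->]]]; [right; exists v; rewrite ?setU11|left|
    right; exists i; rewrite ?inE ?iC ?orbT].
by move=> [Qg|[i /setU1P[->|iC] ->]]; [right; left | left | right; right; exists i].
Qed.

Lemma or_vars0 Q h : ideal_of Q h <-> ideal_of (or_vars Q set0) h.
Proof.
by apply: ideal_of_iff => g; split=> [Qg|[Qg|[i]]] //; [left | rewrite inE].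
Qed.

Lemma adjoin_vars1 Q v h :
  adjoin (ideal_of Q) 'X_v h <-> ideal_of (or_vars Q [set v]) h.
Proof.
rewrite -[[set v]]setU0; apply: iff_trans (adjoin_or_vars _ _ _ _).
split=> -[a [c [Ia ->]]]; exists a, c; split=> //; first exact: (or_vars0 _ _).1.
exact: (or_vars0 _ _).2.
Qed.

Lemma adjoin_vars C v h :
  adjoin (ideal_of (vars C)) 'X_v h <-> ideal_of (vars (v |: C)) h.
Proof.
apply: iff_trans (adjoin_ideal_of _ _ _) _; apply: ideal_of_iff => g; split.
  by move=> [->|[i iC ->]]; [exists v; rewrite ?setU11 | exists i; rewrite ?inE ?iC ?orbT].
by move=> [i /setU1P[->|iC] ->]; [left | right; exists i].
Qed.

(** Both halves are proved together: modulo (x_C) the first term e_(d+1) is the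
    product of the other variables, which leads to the second kind of ideal with
    d; there each factor x_i of the product is peeled off by a link, which leads
    to (x_C, x_i), of the first kind. *)
Lemma wreg_vars d :
  (forall C, (#|C| + d = n)%N -> wreg (ideal_of (vars C)) (esyms d)) /\
  (forall C U, (#|C| + d.+1 = n)%N -> [disjoint C & U] ->
     wreg (ideal_of (or_vars (eq (mono U)) C)) (esyms d)).
Proof.
elim: d => [|d [IHv IHm]]; first by [].
have Hv C : (#|C| + d.+1 = n)%N -> wreg (ideal_of (vars C)) (esyms d.+1).
  move=> cC; have idC := ideal_of_ideal (vars C).
  have mC := mesym_mod_vars cC.
  rewrite esymsS; split.
    move=> h Ih; apply: (@regular_mod_mono _ (~: C)).
      by move=> i; rewrite inE => iC; apply: regular_var => g; apply: kill_vars.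
    have := ideal_likeMr idC h mC; rewrite mulrBl => /(ideal_likeN idC).
    by move=> /(ideal_likeD idC)/(_ Ih); rewrite opprB subrK.
  have dCC : [disjoint C & ~: C] by rewrite -setI_eq0 setICr.
  apply: wreg_ext (IHm C (~: C) cC dCC) => h.
  split.
    apply: ideal_of_min; first exact: adjoin_ideal.
    move=> g [<-|Vg]; last by apply: adjoin_sub; apply: ideal_of_mem.
    exists (- (mesym n K d.+1 - mono (~: C))), 1; split; first exact: ideal_likeN.
    by rewrite mul1r opprB subrK.
  have sC g : ideal_of (vars C) g -> ideal_of (or_vars (eq (mono (~: C))) C) g.
    by apply: ideal_of_sub => g' Vg; apply: ideal_of_mem; right.
  apply: adjoin_min; [exact: ideal_of_ideal | exact: sC |].
  rewrite -[mesym n K _](subrK (mono (~: C))); apply: ideal_likeD.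
  - exact: ideal_of_ideal.
  - exact: sC.
  - by apply: ideal_of_mem; left.
split=> // C U cC dCU.
elim: {U}#|U| {-2}U (erefl #|U|) dCU => [|k IHk] U cU dCU.
  apply: wreg_unit; first exact: ideal_of_ideal.
  by apply: ideal_of_mem; left; rewrite (cards0_eq cU) /mono big_set0.
have /set0Pn[i iU] : U != set0 by rewrite -card_gt0 cU.
have iC : i \notin C by rewrite (disjointFl dCU).
have cU' : #|U :\ i| = k by apply/eqP; rewrite -eqSS -cU [X in _ == X](cardsD1 i) iU.
have dCU' : [disjoint C & U :\ i].
  by apply: disjointWr dCU; apply: subsetDl.
have rX : regular_mod (ideal_of (vars C)) 'X_i.
  by apply: regular_var => g; apply: kill_vars.
have Q21 g : vars C g -> ideal_of (or_vars (eq (mono (U :\ i))) C) g.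
  by move=> Vg; apply: ideal_of_mem; right.
apply: (@wreg_ext _ _ (ideal_of (link 'X_i (or_vars (eq (mono (U :\ i))) C) (vars C)))).
  move=> h; apply: ideal_of_ext => g.
    move=> [[g' [<-|Vg'] ->]|Vg].
    - by apply: ideal_of_mem; left; rewrite -mono_setD1.
    - apply: ideal_likeM; first exact: ideal_of_ideal.
      by apply: ideal_of_mem; right.
    - by apply: ideal_of_mem; right.
  move=> [<-|Vg]; apply: ideal_of_mem; last by right.
  by left; exists (mono (U :\ i)); [left | rewrite -mono_setD1].
apply: (wreg_link rX Q21); first exact: (IHk _ cU' dCU').
apply: (@wreg_ext _ _ (ideal_of (vars (i |: C)))); last first.
  by apply: Hv; rewrite cardsU1 iC add1n addSnnS.
by move=> h; apply: iff_sym; apply: adjoin_vars.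
Qed.

End Monomials.

(** * Algebraic dependence modulo an ideal *)

Section Dependence.
Variables (n : nat) (K : fieldType).
Local Notation S := {mpoly K[n]}.
Implicit Types (Q J : S -> Prop) (f g h q : S)  (C U W : {set 'I_n}).

(** Exponent vectors with k entries bounded by r, as iterated pairs so that the
    first variable can be split off by computation. *)
Fixpoint expo (r k : nat) : finType :=
  if k is k'.+1 then ('I_r.+1 * expo r k')%type : finType else unit.

Fixpoint monom (r k : nat) (f : nat -> S) : expo r k -> S :=
  match k return expo r k -> S with
  | 0 => fun _ => 1
  | k'.+1 => fun a : 'I_r.+1 * expo r k' => f 0%N ^+ a.1 * monom (fun i => f i.+1) a.2
  end.

Lemma msizeM_leq f g : (msize (f * g) <= (msize f + msize g).-1)%N.
Proof.
have [->|nzf] := eqVneq f 0; first by rewrite mul0r msize0.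
have [->|nzg] := eqVneq g 0; first by rewrite mulr0 msize0.
by rewrite msizeM.
Qed.

Lemma card_expo r k : #|expo r k| = (r.+1 ^ k)%N.
Proof. by elim: k => [|k IH] /=; rewrite ?card_unit // card_prod card_ord IH expnS. Qed.

(** Divide by f as long as the constant term b_0 vanishes; once it does not, it
    lies in J', because all other terms are multiples of f. *)
Lemma cancel_lowest J J' f (b : nat -> S) (Z : pred nat) r :
  ideal_like J -> ideal_like J' -> (forall h, J h -> J' h) ->
  regular_mod J f -> J' f ->
  (forall i : nat, Z i -> b i = 0) -> (exists2 i, (i < r)%N & ~~ Z i) ->
  J (\sum_(i < r) f ^+ i * b i) -> exists2 i, (i < r)%N & ~~ Z i /\ J' (b i).
Proof.
move=> idJ idJ' sJ rf Jf; elim: r b Z => [|r IH] b Z bZ; first by case.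
move=> [i0 i0r nZ]; rewrite big_ord_recl expr0 mul1r.
have -> : \sum_(i < r) f ^+ (lift ord0 i) * b (lift ord0 i)
        = f * \sum_(i < r) f ^+ i * b i.+1.
  by rewrite mulr_sumr; apply: eq_bigr => i _; rewrite exprS mulrA.
have [Z0|nZ0] := boolP (Z 0%N); last first.
  move=> /sJ; rewrite addrC => Jsum; exists 0%N => //; split=> //.
  by apply: (ideal_likeDr idJ') Jsum; apply: ideal_likeMr.
rewrite bZ // add0r => /rf Jsum.
have [||i ir []] := IH (fun i => b i.+1) (fun i => Z i.+1) _ _ Jsum.
- by move=> i /bZ.
- by case: i0 i0r nZ => [|i0] i0r nZ; [case/negP: nZ | exists i0].
- by exists i.+1.
Qed.

(** Elements f_0, ..., f_(k-1) that are successively regular modulo J_0, J_1, ...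
    with f_i in J_(i+1) satisfy no relation over K modulo J_0, unless 1 is in
    J_k: the part of the relation with the lowest power of f_0 is a relation of
    the other f_i modulo J_1. *)
Lemma collapse r k (Js : nat -> S -> Prop) (f : nat -> S) (c : expo r k -> K) :
  (forall i, (i <= k)%N -> ideal_like (Js i)) ->
  (forall i, (i < k)%N -> forall h, Js i h -> Js i.+1 h) ->
  (forall i, (i < k)%N -> regular_mod (Js i) (f i)) ->
  (forall i, (i < k)%N -> Js i.+1 (f i)) ->
  (exists a, c a != 0) ->
  Js 0%N (\sum_a (c a)%:MP * monom f a) -> Js k 1.
Proof.
elim: k Js f c => [|k IH] Js f c idJ sJ rf Jf.
  case=> -[nz]; rewrite (bigD1 tt) //= big1 ?addr0 ?mulr1; last by case.
  move=> /(ideal_likeM (idJ 0%N isT) (c tt)^-1%:MP).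
  by rewrite -mpolyCM mulVf // mpolyC1.
case=> -[a0 a1] nz.
pose B (i : 'I_r.+1) := \sum_(a : expo r k) (c (i, a))%:MP * monom (fun i => f i.+1) a.
pose b i := B (inord i).
pose Z i := [forall a : expo r k, c (inord i, a) == 0].
have -> : \sum_(a : expo r k.+1) (c a)%:MP * monom f a = \sum_(i < r.+1) f 0%N ^+ i * b i.
  transitivity (\sum_(i : 'I_r.+1) \sum_(a : expo r k)
       (c (i, a))%:MP * (f 0%N ^+ i * monom (fun i => f i.+1) a)).
    by rewrite pair_bigA; apply: eq_bigr => -[].
  apply: eq_bigr => i _; rewrite /b inord_val mulr_sumr.
  by apply: eq_bigr => a _; rewrite mulrCA.
move=> Jsum.
have [||i ir [nZ Ji]] := @cancel_lowest _ (Js 1%N) _ b Z _ (idJ 0%N isT)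
  (idJ 1%N isT) (sJ 0%N isT) (rf 0%N isT) (Jf 0%N isT) _ _ Jsum.
- by move=> i /forallP Zi; rewrite /b /B big1 // => a _; rewrite (eqP (Zi a)) mpolyC0 mul0r.
- exists (a0 : nat) => //; apply/forallPn; exists a1.
  by rewrite inord_val.
apply: (IH (fun i => Js i.+1) (fun i => f i.+1) (fun a => c (inord i, a))) => //.
- by move=> j jk; apply: idJ.
- by move=> j jk; apply: sJ.
- by move=> j jk; apply: rf.
- by move=> j jk; apply: Jf.
- by move/forallPn: nZ => [a nza]; exists a.
Qed.

Lemma monom_msize r k (f : nat -> S) (a : expo r k) :
  (msize (monom f a) <= (r * \sum_(i < k) msize (f i)).+1)%N.
Proof.
have szX g m : (msize (g ^+ m) <= (m * msize g).+1)%N.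
  elim: m => [|m IH]; first by rewrite expr0 msize1.
  rewrite exprS; apply: leq_trans (msizeM_leq _ _) _; rewrite mulSn; lia.
have leq_predn u v : (u <= v -> u.-1 <= v.-1)%N by lia.
elim: k f a => [|k IH] f a; first by rewrite msize1.
rewrite big_ord_recl mulnDr /=; apply: leq_trans (msizeM_leq _ _) _.
have h1 : (a.1 * msize (f 0%N) <= r * msize (f 0%N))%N by rewrite leq_mul2r -ltnS ltn_ord orbT.
apply: leq_trans (leq_predn _ _ (leq_add (szX (f 0%N) a.1) (IH (fun i => f i.+1) a.2))) _.
by rewrite addnS /= addSn ltnS leq_add2r.
Qed.

Lemma mpolyX_support (m : 'X_{1..n}) :
  exists q, 'X_[m] = q * mono K [set i | m i != 0%N].
Proof.
exists (\prod_(i | m i != 0%N) 'X_i ^+ (m i).-1).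
have -> : mono K [set i | m i != 0%N] = \prod_(i | m i != 0%N) 'X_i.
  by apply: eq_bigl => i; rewrite inE.
rewrite mpolyXE_id -big_split (bigID (fun i => m i != 0%N)) /= [X in _ * X]big1 ?mulr1.
  by apply: eq_bigr => i; rewrite -lt0n => m0; rewrite -exprSr prednK.
by move=> i; rewrite negbK => /eqP ->.
Qed.

(** Modulo I only monomials in at most d variables survive.  With exponents below
    r+1 there are (r+1)^(d+1) products of the f_i, but only O(r^d) surviving
    monomials of the degrees that occur. *)
Lemma dependence I d (f : nat -> S) :
  ideal_like I -> (forall C, (d < #|C|)%N -> I (mono K C)) ->
  exists r (c : expo r d.+1 -> K),
    (exists a, c a != 0) /\ I (\sum_a (c a)%:MP * monom f a).
Proof.
move=> idI bigI; set D := (\sum_(i < d.+1) msize (f i))%N.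
pose r := (2 ^ n * D.+1 ^ d)%N; pose M := (r * D)%N.
pose T2 := ({set 'I_n} * {ffun 'I_d -> 'I_M.+1})%type.
pose mon (t : T2) : 'X_{1..n} := [multinom (if i \in t.1 then
     oapp (fun j => t.2 j : nat) 0%N (insub (index i (enum t.1))) else 0%N) | i < n].
have monP (m : 'X_{1..n}) : (#|[set i | m i != 0%N]| <= d)%N -> (mdeg m <= M)%N ->
    exists t, mon t = m.
  set C := [set i | _] => cC dm.
  exists (C, [ffun t : 'I_d => inord (nth 0%N (map m (enum C)) t)]).
  apply/mnmP => i; rewrite mnmE /=; case: ifP => [iC|]; last first.
    by rewrite inE => /negbT; rewrite negbK => /eqP.
  have lt : (index i (enum C) < #|C|)%N by rewrite cardE index_mem mem_enum.
  rewrite (insubT (fun x => x < d)%N (leq_trans lt cC)) /= ffunE /=.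
  rewrite (nth_map i) -?cardE // nth_index ?mem_enum //.
  by rewrite inordK // ltnS (leq_trans _ dm) // mdegE (bigD1 i) //= leq_addr.
(* Columns are indexed by a set of variables together with d exponents; this
   repeats monomials, which does no harm to the count. *)
pose A : 'M[K]_(#|expo r d.+1|, #|T2 : finType|) :=
  \matrix_(i, j) (monom f (enum_val i))@_(mon (enum_val j)).
have ltT : (#|T2 : finType| < #|expo r d.+1|)%N.
  rewrite card_expo card_prod card_ffun !card_ord -cardsT -powersetT card_powerset.
  rewrite cardsT card_ord expnS.
  have le1 : (M.+1 <= r.+1 * D.+1)%N by rewrite /M; lia.
  have le2 : (2 ^ n * M.+1 ^ d <= 2 ^ n * D.+1 ^ d * r.+1 ^ d)%N.
    rewrite -mulnA -expnMn leq_mul2l [(D.+1 * _)%N]mulnC; apply/orP; right.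
    by case: (posnP d) => [->|d0]; rewrite ?expn0 // leq_exp2r.
  apply: leq_ltn_trans le2 _.
  by rewrite -/r mulSn -[X in (X < _)%N]add0n ltn_add2r expn_gt0.
have /matrix0Pn [i0 [j0 nz]] : kermx A != 0.
  rewrite kermx_eq0 /row_free neq_ltn (leq_ltn_trans (rank_leq_col A)) //.
(* a nontrivial row relation between the products of the f_i *)
pose c (a : expo r d.+1) := kermx A i0 (enum_rank a).
exists r, c; split; first by exists (enum_val j0); rewrite /c enum_valK.
set p := \sum_a _.
have p0 t : p@_(mon t) = 0.
  have := mulmx_ker A => /matrixP/(_ i0 (enum_rank t)); rewrite mxE [RHS]mxE => <-.
  rewrite raddf_sum /= (reindex (@enum_val (expo r d.+1) xpredT)) /=; last first.
    exact/onW_bij/enum_val_bij.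
  by apply: eq_bigr => j _; rewrite mcoeffCM [A _ _]mxE enum_rankK /c enum_valK.
have pdeg m : m \in msupp p -> (mdeg m <= M)%N.
  move=> /msize_mdeg_lt ltm; rewrite -ltnS; apply: (leq_trans ltm).
  apply: leq_trans (msize_sum _ _ _) _; apply/bigmax_leqP => a _.
  rewrite mul_mpolyC; apply: leq_trans (msizeZ_le _ _) _; exact: monom_msize.
rewrite [p]mpolyE big_seq; apply: ideal_like_sum => // m mp.
rewrite -mul_mpolyC; apply: ideal_likeM => //.
have [q ->] := mpolyX_support m; apply: ideal_likeM => //; apply: bigI.
rewrite ltnNge; apply/negP => cC.
have [t et] := monP m cC (pdeg m mp).
by move: mp; rewrite mcoeff_msupp -et p0 eqxx.
Qed.

End Dependence.

(** * Krull dimension and depth *)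

Section Invariants.
Variables (n : nat) (K : fieldType).
Local Notation S := {mpoly K[n]}.
Implicit Types (I J : S -> Prop) (f g h q : S) (C U W : {set 'I_n}).

Definition adjoins J (fs : seq S) : S -> Prop := foldl (@adjoin n K) J fs.

Lemma adjoins_ideal J fs : ideal_like J -> ideal_like (adjoins J fs).
Proof. by elim: fs J => //= f fs IH J idJ; apply/IH/adjoin_ideal. Qed.

Lemma adjoins_rcons J fs f : adjoins J (rcons fs f) = adjoin (adjoins J fs) f.
Proof. exact: foldl_rcons. Qed.

Lemma adjoins_take J fs k : (k < size fs)%N ->
  adjoins J (take k.+1 fs) = adjoin (adjoins J (take k fs)) fs`_k.
Proof. by move=> lt; rewrite (take_nth 0) // adjoins_rcons. Qed.

Lemma adjoins_sub J fs k h : adjoins J (take k fs) h -> adjoins J fs h.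
Proof.
rewrite -[in X in _ -> X](cat_take_drop k fs) /adjoins foldl_cat.
move: (foldl _ _ (take _ _)) => J'; elim: (drop _ _) J' => //= f s IH J' Jh.
exact/IH/adjoin_sub.
Qed.

Lemma ideal_plusE J fs h : ideal_like J -> ideal_plus J fs h <-> adjoins J fs h.
Proof.
move=> idJ; elim/last_ind: fs h => [|fs f IH] h.
  split=> [[u [v [Ju [c ->] ->]]]|Jh]; first by rewrite big_ord0 addr0.
  by exists h, 0; split; rewrite ?addr0 //; exists (fun=> 0); rewrite big_ord0.
rewrite adjoins_rcons; split.
  move=> [u [v [Ju [c ->] ->]]]; rewrite size_rcons big_ord_recr /= nth_rcons ltnn eqxx.
  exists (u + \sum_(i < size fs) c i * fs`_i), (c (size fs)); rewrite addrA; split=> //.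
    by apply/IH; exists u, (\sum_(i < size fs) c i * fs`_i); split=> //; exists c.
  congr (_ + _ + _); apply: eq_bigr => i _.
  by rewrite nth_rcons ltn_ord.
move=> [_ [c [/IH [u [_ [Ju [d ->] ->]]] ->]]].
exists u, (\sum_(i < size fs) d i * fs`_i + c * f); rewrite addrA; split=> //.
exists (fun i => if (i < size fs)%N then d i else c).
rewrite size_rcons big_ord_recr /= nth_rcons !ltnn eqxx; congr (_ + _).
by apply: eq_bigr => i _; rewrite nth_rcons ltn_ord.
Qed.

Lemma wreg_nth J fs k : wreg J fs -> (k < size fs)%N ->
  regular_mod (adjoins J (take k fs)) fs`_k.
Proof.
elim: fs J k => // f fs IH J [|k] [rf wf] lt; first by rewrite take0.
exact: (IH _ _ wf lt).
Qed.

Lemma mesym_const d : (0 < d)%N -> (mesym n K d)@_0%MM = 0.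
Proof. by move=> d0; rewrite mcoeff_mesym /mechar mdeg0 eq_sym eqn0Ngt d0. Qed.

Lemma const_ideal_like : ideal_like (fun f : S => f@_0%MM = 0).
Proof.
split; first by rewrite mcoeff0.
- by move=> f g f0 g0; rewrite mcoeffD f0 g0 addr0.
- by move=> c f f0; rewrite rmorphM /= f0 mulr0.
Qed.

Lemma regular_seq_esyms I d : ideal_like I -> (forall f, I f -> f@_0%MM = 0) ->
  wreg I (esyms n K d) -> regular_seq I (esyms n K d).
Proof.
move=> idI I0 wI.
have pos f : f \in esyms n K d -> exists2 k, (0 < k)%N & f = mesym n K k.
  move=> /mapP [k]; rewrite mem_rev mem_iota => /andP[k0 _] ->.
  by exists k.
split.
- by move=> f /pos [k k0 ->]; exists k => //; apply: dhomog_mesym.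
- move=> k lt h /(ideal_plusE _ _ idI) Ih; apply/(ideal_plusE _ _ idI).
  exact: (wreg_nth wI lt) Ih.
- move=> /(ideal_plusE _ _ idI).
  have : forall J, (forall f, J f -> f@_0%MM = 0) ->
      forall f, adjoins J (esyms n K d) f -> f@_0%MM = 0.
    elim: (esyms n K d) pos => //= f fs IH pos J J0; apply: IH.
      by move=> g gfs; apply: pos; rewrite inE gfs orbT.
    move=> g; apply: (adjoin_min const_ideal_like) => //.
    by have [|k k0 ->] := pos f; [rewrite inE eqxx | apply: mesym_const].
  by move=> /(_ I I0 1) H /H; rewrite mcoeff1 eqxx; apply/eqP/oner_neq0.
Qed.

(** A dependence relation of elements f_k of P_(k+1) outside P_k collapses. *)
Lemma prime_chain_bound I d d' : ideal_like I ->
  (forall C, (d < #|C|)%N -> I (mono K C)) -> prime_chain I d' -> (d' <= d)%N.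
Proof.
move=> idI bigI [P [Pprime Plt]]; rewrite leqNgt; apply/negP => dd'.
have idP k : (k <= d')%N -> ideal_like (fun f => f \in P k).
  move=> /Pprime [[P0 _ PD] _ _].
  split=> //; first by move=> f g fP gP; rewrite -[f]mul1r PD.
  by move=> c f fP; rewrite -[_ * _]addr0 PD.
have ex k : exists f, (k < d')%N -> f \in P k.+1 /\ f \notin P k.
  case: (boolP (k < d')%N) => [|_]; last by exists 0.
  move=> /Plt [_ nsub]; apply: Classical_Prop.NNPP => nex; apply: nsub => f fP.
  by apply: contraT => nf; case: nex; exists f.
pose f k := proj1_sig (constructive_indefinite_description _ (ex k)).
have fP k : (k < d')%N -> f k \in P k.+1 /\ f k \notin P k.
  exact: (proj2_sig (constructive_indefinite_description _ (ex k))).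
have [r [c [nz Ic]]] := dependence f idI bigI.
have le k : (k <= d.+1)%N -> (k <= d')%N by move=> /leq_trans; apply.
have := @collapse _ _ r d.+1 (fun k g => g \in P k) f c.
case: (Pprime d.+1 dd') => -[_ /negP H1 _] _ _; move=> H; apply: H1; apply: H => //.
- by move=> i /le; apply: idP.
- by move=> i /le /Plt [].
- move=> i /le lt h; have [_ pr _] := Pprime i (ltnW lt).
  by move=> /pr; rewrite (negPf (fP i lt).2).
- by move=> i /le /fP [].
- by have [_ _] := Pprime 0%N (leq0n _); apply.
Qed.

(** Here the dependence relation collapses along the regular sequence itself. *)
Lemma regular_seq_bound I d fs : ideal_like I ->
  (forall C, (d < #|C|)%N -> I (mono K C)) -> regular_seq I fs -> (size fs <= d)%N.
Proof.
move=> idI bigI [_ reg n1]; rewrite leqNgt; apply/negP => ltd.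
have [r [c [nz Ic]]] := dependence (fun i => fs`_i) idI bigI.
apply/n1/(ideal_plusE _ _ idI)/(@adjoins_sub _ _ d.+1).
apply: (@collapse _ _ r d.+1 (fun k => adjoins I (take k fs)) (fun i => fs`_i) c) => //.
- by move=> i _; apply: adjoins_ideal.
- by move=> i /leq_trans/(_ ltd) lt h; rewrite adjoins_take //; apply: adjoin_sub.
- move=> i /leq_trans/(_ ltd) lt h /(ideal_plusE _ _ idI)/(reg _ lt).
  by move/(ideal_plusE _ _ idI).
- move=> i /leq_trans/(_ ltd) lt; rewrite adjoins_take //; apply: adjoin_mem.
  exact: adjoins_ideal.
- by rewrite take0.
Qed.

(** The primes generated by C and the first k further variables. *)
Lemma prime_chain_vars I C d : (#|C| + d = n)%N ->
  (forall f, I f -> kill C f = 0) -> prime_chain I d.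
Proof.
move=> cC killI.
have cCC : #|~: C| = d by rewrite cardsCs setCK card_ord; apply: (canLR (addKn _)).
pose D k := C :|: [set i in take k (enum (~: C))].
exists (fun k => [pred f : S | kill (D k) f == 0] : {pred S}); split=> k kd.
  split; first split.
  - by rewrite inE rmorph0.
  - by rewrite inE rmorph1 oner_neq0.
  - by move=> a u v /eqP u0 /eqP v0; rewrite inE rmorphD rmorphM /= u0 v0 mulr0 addr0.
  - by move=> u v; rewrite !inE rmorphM mulf_eq0.
  - move=> f /killI; rewrite inE => f0.
    have -> : kill (D k) f = kill (D k) (f - kill C f) by rewrite f0 subr0.
    apply/eqP; move: (sub_kill C f).
    apply: (@ideal_of_min _ _ _ (fun g => kill (D k) g = 0)).
      split; first exact: rmorph0.
      + by move=> u v u0 v0; rewrite rmorphD /= u0 v0 addr0.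
      + by move=> c u u0; rewrite rmorphM /= u0 mulr0.
    by move=> _ [i iC ->]; rewrite killX inE iC.
have sz : (k < size (enum (~: C)))%N by rewrite -cardE cCC.
have [i0 _] : exists i0 : 'I_n, True.
  by move: sz; case: (enum _) => // i0; exists i0.
set i := nth i0 (enum (~: C)) k.
have iD : i \notin D k.
  have : i \in ~: C by rewrite -mem_enum mem_nth.
  rewrite /D !inE negb_or => -> /=.
  have := enum_uniq (~: C); rewrite -[X in uniq X](cat_take_drop k) cat_uniq.
  move=> /and3P[_ /hasPn + _]; apply.
  by rewrite (drop_nth i0) // mem_head.
have iD' : i \in D k.+1.
  by rewrite /D !inE (take_nth i0) // mem_rcons mem_head orbT.
have DD' : D k \subset D k.+1.
  apply: setUS; apply/subsetP => j; rewrite !inE (take_nth i0) // mem_rcons inE => ->.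
  by rewrite orbT.
split.
  move=> f; rewrite !inE => /eqP f0.
  have -> : kill (D k.+1) f = kill (D k.+1) (f - kill (D k) f) by rewrite f0 subr0.
  apply/eqP; move: (sub_kill (D k) f).
  apply: (@ideal_of_min _ _ _ (fun g => kill (D k.+1) g = 0)).
    split; first exact: rmorph0.
    + by move=> u v u0 v0; rewrite rmorphD /= u0 v0 addr0.
    + by move=> c u u0; rewrite rmorphM /= u0 mulr0.
  by move=> _ [j jC ->]; rewrite killX (subsetP DD').
move=> /(_ 'X_i); rewrite !inE !killX iD' eqxx => /(_ isT).
by rewrite (negPf iD) (negPf (mpolyX_neq0 K i)).
Qed.

(** The chain of primes starts at (x_i : i in C). *)
Lemma cohen_macaulay_vars I C d : ideal_like I -> (forall f, I f -> f@_0%MM = 0) ->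
  (#|C| + d = n)%N -> (forall f, I f -> kill C f = 0) ->
  (forall U, (d < #|U|)%N -> I (mono K U)) -> wreg I (esyms n K d) ->
  cohen_macaulay I.
Proof.
move=> idI I0 cC killI bigI wI; exists d; split.
- exact: prime_chain_vars killI.
- by move=> d'; apply: prime_chain_bound.
- exists (esyms n K d); first exact: regular_seq_esyms.
  by rewrite size_map size_rev size_iota.
- by move=> fs; apply: regular_seq_bound.
Qed.

Lemma cohen_macaulay_regular_seq I e : cohen_macaulay I -> prime_chain I e ->
  exists2 fs, regular_seq I fs & (e <= size fs)%N.
Proof. by move=> [d [_ maxd] [[fs rfs sz] _]] /maxd le; exists fs; rewrite ?sz. Qed.

End Invariants.

(** * Koszul homology and regular sequences *)

(** Koszul chains with coefficients in S are alternating functions on lists of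
    vertices; those of degree i only matter on lists of length i.  This makes
    the differential and the product with a 1-chain free of explicit signs. *)
Section Koszul.
Variables (n : nat) (K : fieldType).
Local Notation S := {mpoly K[n]}.
Local Notation cochain := (seq 'I_n -> S).
Implicit Types (J : S -> Prop) (f : S) (z u w : cochain) (g : 'I_n -> S) (s t : seq 'I_n).

Definition kdiff z : cochain := fun t => \sum_j 'X_j * z (j :: t).

(** The product of the 1-chain g with z. *)
Fixpoint wedge g z t : S :=
  if t is a :: t' then g a * z t' - wedge g (fun s => z (a :: s)) t' else 0.

Definition alternating z :=
  (forall s a t, z (s ++ a :: a :: t) = 0) /\
  (forall s a b t, z (s ++ a :: b :: t) = - z (s ++ b :: a :: t)).

Lemma wedge_eq g z w t : z =1 w -> wedge g z t = wedge g w t.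
Proof.
elim: t z w => //= a t IH z w eqzw; rewrite eqzw; congr (_ - _).
by apply: IH => s; apply: eqzw.
Qed.

Lemma wedge_lin g (I : finType) (c : I -> S) (Z : I -> cochain) t :
  wedge g (fun s => \sum_i c i * Z i s) t = \sum_i c i * wedge g (Z i) t.
Proof.
elim: t Z => [|a t IH] Z /=; first by rewrite big1 // => i _; rewrite mulr0.
rewrite IH mulr_sumr -sumrB; apply: eq_bigr => i _.
by rewrite mulrBr mulrCA.
Qed.

Lemma wedgeN g z t : wedge g (fun s => - z s) t = - wedge g z t.
Proof.
elim: t z => [|a t IH] z /=; first by rewrite oppr0.
by rewrite IH mulrN opprB opprK addrC.
Qed.

Lemma wedge0 g t : wedge g (fun=> 0) t = 0.
Proof. by elim: t => //= a t ->; rewrite mulr0 subr0. Qed.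

Lemma wedge_ideal J g z t : ideal_like J ->
  (forall s, (size s).+1 = size t -> J (z s)) -> J (wedge g z t).
Proof.
move=> idJ; elim: t z => [|a t IH] z Jz /=; first exact: ideal_like0.
apply: ideal_likeB => //; first by apply: ideal_likeM => //; apply: Jz.
by apply: IH => s es; apply: Jz; rewrite /= es.
Qed.

Lemma alternating_cons z a : alternating z -> alternating (fun s => z (a :: s)).
Proof. by case=> z0 zN; split=> s *; [apply: (z0 (a :: s)) | apply: (zN (a :: s))]. Qed.

Lemma alternating_wedge g z : alternating z -> alternating (wedge g z).
Proof.
move=> az; split=> s.
  elim: s z az => [|b s IH] z az a t /=.
    rewrite opprB addrC subrK; case: az => z0 _.
    by rewrite (@wedge_eq _ _ (fun=> 0)) ?wedge0 // => s; apply: (z0 [::]).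
  rewrite (IH _ (alternating_cons b az)) subr0; case: az => -> _.
  by rewrite mulr0.
elim: s z az => [|c s IH] z az a b t /=.
  case: az => _ zN.
  rewrite (@wedge_eq _ (fun s => z [:: a, b & s]) (fun s => - z [:: b, a & s])); last first.
    by move=> s; apply: (zN [::]).
  by rewrite wedgeN; ring.
rewrite (IH _ (alternating_cons c az)); case: az => _ ->.
by rewrite mulrN opprB opprK addrC.
Qed.

(** The product with g is a homotopy between 0 and multiplication by
    \sum_j x_j g_j. *)
Lemma kdiff_wedge g z t :
  kdiff (wedge g z) t = (\sum_j 'X_j * g j) * z t - wedge g (kdiff z) t.
Proof.
rewrite /kdiff /= mulr_suml wedge_lin -sumrB; apply: eq_bigr => j _.
by rewrite mulrBr mulrA.
Qed.

Lemma kdiff_kdiff z t : alternating z -> kdiff (kdiff z) t = 0.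
Proof.
move=> [z0 zN]; pose F (j k : 'I_n) := 'X_j * ('X_k * z [:: k, j & t]).
have -> : kdiff (kdiff z) t = \sum_j \sum_k F j k.
  by apply: eq_bigr => j _; rewrite /kdiff mulr_sumr.
have Fdiag j : F j j = 0 by rewrite /F (z0 [::]) !mulr0.
have Fanti j k : F j k = - F k j by rewrite /F (zN [::]) !mulrN mulrCA.
have -> : \sum_j \sum_k F j k = \sum_(j < n) \sum_(k < n | (k < j)%N) (F j k + F k j).
  have split3 j : \sum_k F j k =
      \sum_(k < n | (k < j)%N) F j k + \sum_(k < n | (j < k)%N) F j k.
    rewrite (bigID (fun k : 'I_n => (k < j)%N)) /=; congr (_ + _).
    rewrite (bigD1 j) ?ltnn //= Fdiag add0r; apply: eq_bigl => k.
    by rewrite -leqNgt [in RHS]ltn_neqAle andbC eq_sym.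
  under eq_bigr do rewrite split3.
  rewrite big_split /=; under [in RHS]eq_bigr do rewrite big_split /=.
  rewrite big_split /=; congr (_ + _).
  by rewrite (exchange_big_dep predT).
by rewrite big1 // => j _; rewrite big1 // => k _; rewrite Fanti addNr.
Qed.

Fixpoint inversions t : nat :=
  if t is a :: t' then count (fun b : 'I_n => b < a)%N t' + inversions t' else 0.

Lemma inversions_swap s (a b : 'I_n) t : (b < a)%N ->
  inversions (s ++ a :: b :: t) = (inversions (s ++ b :: a :: t)).+1.
Proof.
move=> ba; elim: s => [|c s /= ->] /=; first by rewrite ba ltnNge (ltnW ba) /=; lia.
by rewrite !count_cat /= addnS (addnCA (c > a)%N).
Qed.

Definition strictly_sorted t := sorted (fun a b : 'I_n => a < b)%N t.

Lemma not_sorted t : ~~ strictly_sorted t ->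
  exists s a b t', t = s ++ a :: b :: t' /\ (b <= a)%N.
Proof.
case: t => // a t; rewrite /strictly_sorted /=.
elim: t a => //= b t IH a; rewrite negb_and -leqNgt.
case/orP=> [ba|/IH [s [c [d [t' [-> cd]]]]]]; first by exists [::], a, b, t.
by exists (a :: s), c, d, t'.
Qed.

(** Bubble sort: each swap of a descent lowers the number of inversions. *)
Lemma sorted_suffices J z m : ideal_like J -> alternating z ->
  (forall t, strictly_sorted t -> size t = m -> J (z t)) ->
  forall t, size t = m -> J (z t).
Proof.
move=> idJ [z0 zN] Jz t; move: {2}(inversions t) (leqnn (inversions t)) => k.
elim: k t => [|k IH] t.
  have [st _|] := boolP (strictly_sorted t); first exact: Jz.
  move=> /not_sorted [s [a [b [t' [-> ba]]]]].
  move: ba; rewrite leq_eqVlt => /orP[/eqP/val_inj ->|ba].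
    by rewrite z0 => *; apply: ideal_like0.
  by rewrite inversions_swap.
have [st _|] := boolP (strictly_sorted t); first exact: Jz.
move=> /not_sorted [s [a [b [t' [-> ba]]]]].
move: ba; rewrite leq_eqVlt => /orP[/eqP/val_inj ->|ba].
  by rewrite z0 => *; apply: ideal_like0.
rewrite inversions_swap // ltnS zN => /IH + sz => /(_ _)/(ideal_likeN idJ); apply.
by rewrite -sz !size_cat.
Qed.

(** The alternating function that agrees with v on strictly sorted lists. *)
Definition alt_extension (v : cochain) : cochain := fun t =>
  if uniq t then (-1) ^+ inversions t * v (sort (fun a b : 'I_n => a <= b)%N t) else 0.

Lemma alternating_extension v : alternating (alt_extension v).
Proof.
rewrite /alt_extension; split=> s a.
  by move=> t; rewrite cat_uniq /= mem_head !andbF.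
move=> b t; have P : perm_eq (s ++ a :: b :: t) (s ++ b :: a :: t).
  by rewrite perm_cat2l; apply/permPl/(perm_catCA [:: a] [:: b]).
rewrite (perm_uniq P); case: ifP => [|_]; last by rewrite oppr0.
rewrite cat_uniq => /and3P[_ _]; rewrite /= inE negb_or => /andP[/andP[/eqP nab _] _].
have -> : sort (fun a b : 'I_n => a <= b)%N (s ++ a :: b :: t) =
          sort (fun a b : 'I_n => a <= b)%N (s ++ b :: a :: t).
  apply/perm_sortP => //.
  - by move=> x y; apply: leq_total.
  - by move=> x y z; apply: leq_trans.
  - by move=> x y /anti_leq/val_inj.
case: (ltngtP a b) => [ab|ba|/val_inj eab].
- by rewrite (inversions_swap _ _ ab) exprS mulN1r mulNr opprK.
- by rewrite (inversions_swap _ _ ba) exprS mulN1r mulNr.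
- by case: nab.
Qed.

Lemma strictly_sorted_uniq t : strictly_sorted t -> uniq t.
Proof.
apply: sorted_uniq => [b a c|a]; first exact: ltn_trans.
exact: ltnn.
Qed.

Lemma alt_extension_sorted v t : strictly_sorted t -> alt_extension v t = v t.
Proof.
move=> st; rewrite /alt_extension strictly_sorted_uniq // sorted_sort.
- have -> : inversions t = 0%N; last by rewrite mul1r.
  elim: t st => //= a t IH st; rewrite (IH (path_sorted st)) addn0.
  have := order_path_min _ st; move=> /(_ _)/allP H.
  apply/eqP; rewrite -leqn0 leqNgt -has_count; apply/hasPn => b /H.
  by rewrite -leqNgt => /(_ (fun _ _ _ => @ltn_trans _ _ _))/ltnW.
- by move=> b a c; apply: leq_trans.
- by apply: sub_sorted st => a b; apply: ltnW.
Qed.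

(** H_(i+1)(x; S/J) is nonzero: z is an alternating chain over S that is a cycle
    but not a boundary modulo J. *)
Definition koszul_class J i :=
  exists z, [/\ alternating z, forall t, size t = i -> J (kdiff z t)
    & ~ exists u, alternating u /\ forall t, size t = i.+1 -> J (z t - kdiff u t)].

(** If z is a cycle modulo J, so is wedge g z modulo J + (f), its differential
    being f z up to J.  If it were the boundary of u up to f v, then applying the
    differential would give f z = f dv modulo J, hence z = dv modulo J. *)
Lemma koszul_class_step J f g i : ideal_like J -> regular_mod J f ->
  f = \sum_j 'X_j * g j -> koszul_class J i -> koszul_class (adjoin J f) i.+1.
Proof.
move=> idJ rf ef [z [az Jz nz]]; have idJ' := adjoin_ideal f idJ.
exists (wedge g z); split; first exact: alternating_wedge.
  move=> t st; rewrite kdiff_wedge -ef; apply: (ideal_likeB idJ').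
    by rewrite mulrC; apply: (ideal_likeM idJ'); apply: adjoin_mem.
  by apply/adjoin_sub/(wedge_ideal _ idJ) => s; rewrite st => -[es]; apply: Jz.
move=> [u [au Ju]]; apply: nz.
have ex t : exists c, size t = i.+2 -> J (wedge g z t - kdiff u t - f * c).
  case: (boolP (size t == i.+2)) => [/eqP/Ju [a [c [Ja ->]]]|/eqP nt]; last by exists 0.
  by exists c => _; rewrite mulrC addrK.
pose v0 t := proj1_sig (constructive_indefinite_description _ (ex t)).
have v0P t : size t = i.+2 -> J (wedge g z t - kdiff u t - f * v0 t).
  exact: (proj2_sig (constructive_indefinite_description _ (ex t))).
pose v := alt_extension v0; have av : alternating v := alternating_extension v0.
pose y t := wedge g z t - kdiff u t - f * v t.
have akd : alternating (kdiff u).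
  by case: au => u0 uN; split=> s *; rewrite /kdiff;
    [rewrite big1 // => j _; rewrite (u0 (j :: s)) mulr0
    | rewrite -sumrN; apply: eq_bigr => j _; rewrite (uN (j :: s)) mulrN].
have ay : alternating y.
  have [w0 wN] := alternating_wedge g az; have [k0 kN] := akd; have [v0' vN] := av.
  split=> *; rewrite /y; first by rewrite w0 k0 v0' mulr0 !subr0.
  by rewrite wN kN vN mulrN !opprB !opprK; ring.
have Jy : forall t, size t = i.+2 -> J (y t).
  apply: sorted_suffices => // t st szt; rewrite /y /v alt_extension_sorted //.
  exact: v0P.
exists v; split=> // t st; apply: rf.
have : J (kdiff y t).
  by apply: ideal_like_sum => // j _; apply: ideal_likeM => //; apply: Jy; rewrite /= st.
have -> : kdiff y t = f * (z t - kdiff v t) - wedge g (kdiff z) t.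
  have -> : kdiff y t = kdiff (wedge g z) t - kdiff (kdiff u) t - f * kdiff v t.
    rewrite /kdiff mulr_sumr -!sumrB; apply: eq_bigr => j _; rewrite /y /kdiff; ring.
  by rewrite kdiff_kdiff // kdiff_wedge -ef; ring.
move=> /(ideal_likeD idJ) H; rewrite -[_ * _](subrK (wedge g (kdiff z) t)); apply: H.
by apply: wedge_ideal => // s es; apply: Jz; rewrite st in es; case: es.
Qed.

(** Alternating functions vanish on lists with more than n entries. *)
Lemma koszul_class_top J i : ideal_like J -> koszul_class J i -> (i < n)%N.
Proof.
move=> idJ [z [az _ nz]]; rewrite ltnNge; apply/negP => ni; apply: nz.
exists (fun=> 0); split; first by split=> *; rewrite ?oppr0.
move=> t st; rewrite /kdiff big1 ?subr0; last by move=> j _; rewrite mulr0.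
move: t st; apply: sorted_suffices => // t srt szt.
have := max_card (mem t); rewrite (card_uniqP (strictly_sorted_uniq srt)).
by rewrite card_ord szt ltnNge ni.
Qed.

Lemma in_irrelevant_ideal f : f@_0%MM = 0 -> exists g, f = \sum_j 'X_j * g j.
Proof.
suff [g eg] : exists g, f = (f@_0%MM)%:MP + \sum_j 'X_j * g j.
  by move=> f0; exists g; rewrite [LHS]eg f0 mpolyC0 add0r.
elim/mpolyind: f => [|c m p _ _ [g IH]].
  by exists (fun=> 0); rewrite mcoeff0 mpolyC0 add0r big1 // => j _; rewrite mulr0.
rewrite mcoeffD mpolyCD mcoeffZ mcoeffX.
have [->|m0] := eqVneq m 0%MM.
  by exists g; rewrite mulr1 mpolyX0 alg_mpolyC -addrA -IH.
have [i mi] : exists i, m i != 0%N.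
  apply/existsP; apply: contraT; rewrite negb_exists => /forallP mE.
  by case/eqP: m0; apply/mnmP => i; rewrite mnm0E; apply/eqP; move: (mE i); rewrite negbK.
exists (fun j => (if j == i then c *: 'X_[m - U_(i)] else 0) + g j).
under eq_bigr do rewrite mulrDr.
rewrite big_split /= (bigD1 i) //= eqxx big1 ?addr0; last first.
  by move=> j /negPf ->; rewrite mulr0.
rewrite mulr0 mpolyC0 add0r addrCA -IH; congr (_ + _).
by rewrite -scalerAr -mpolyXD addmC submK // lep1mP.
Qed.

(** Each element of the sequence raises the degree of the class by one. *)
Lemma koszul_class_regular_seq I i fs : ideal_like I -> koszul_class I i ->
  regular_seq I fs -> (size fs + i < n)%N.
Proof.
move=> idI kI [hom reg _].
suff H k : (k <= size fs)%N -> koszul_class (adjoins I (take k fs)) (k + i).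
  have := H _ (leqnn _); rewrite take_size; apply: koszul_class_top.
  exact: adjoins_ideal.
elim: k => [|k IH] lt; first by rewrite take0.
rewrite adjoins_take //; have [|g eg] := @in_irrelevant_ideal fs`_k.
  have [d d0 hd] := hom _ (mem_nth 0 lt).
  apply/eqP; apply: contraT; rewrite -mcoeff_msupp => /(dhomog_mf hd).
  by rewrite /= mdeg0 => e; rewrite -e in d0.
apply: (koszul_class_step _ _ eg (IH (ltnW lt))); first exact: adjoins_ideal.
by move=> h /(ideal_plusE _ _ idI)/(reg _ lt)/(ideal_plusE _ _ idI).
Qed.

End Koszul.

(** * The Koszul class of a cycle *)

Section CycleClass.
Variables (n : nat) (K : fieldType).
Local Notation S := {mpoly K[n]}.
Local Notation cochain := (seq 'I_n -> S).
Implicit Types (J : S -> Prop) (f : S) (z u w : cochain) (g h : 'I_n -> S) (s t p : seq 'I_n).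
Implicit Types (a b c : 'I_n) (W : {set 'I_n}).

Lemma monoE W : mono K W = 'X_[mesym1 W].
Proof.
rewrite mpolyXE_id /mono big_mkcond; apply: eq_bigr => i _.
by rewrite mnmE; case: (i \in W); rewrite ?expr1 ?expr0.
Qed.

Lemma mono_neq0 W : mono K W != 0.
Proof. by rewrite monoE -msize_poly_eq0 msizeX. Qed.

(** Bounds the order of vanishing at the origin. *)
Definition order_ge k f := forall m, m \in msupp f -> (k <= mdeg m)%N.

Lemma order_ge_sum k (I : Type) (r : seq I) (F : I -> S) :
  (forall i, order_ge k (F i)) -> order_ge k (\sum_(i <- r) F i).
Proof.
move=> oF; apply: (@big_ind S (order_ge k)) => //.
- by move=> m; rewrite msupp0.
- by move=> x y ox oy m /msuppD_le; rewrite mem_cat => /orP[/ox|/oy].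
Qed.

Lemma order_geM k l f1 f2 : order_ge k f1 -> order_ge l f2 -> order_ge (k + l) (f1 * f2).
Proof.
move=> o1 o2 m /msuppM_le /allpairsP [[m1 m2] [/= /o1 d1 /o2 d2 ->]].
by rewrite mdegD leq_add.
Qed.

Definition unit_cochain : cochain := fun t => if t is [::] then 1 else 0.
Definition dirac a : 'I_n -> S := fun i => (i == a)%:R.

Lemma alternating_unit : alternating unit_cochain.
Proof. by split; case=> *; rewrite /= ?oppr0. Qed.

Lemma alternatingD z w : alternating z -> alternating w -> alternating (fun t => z t + w t).
Proof.
move=> [z0 zN] [w0 wN]; split=> *; first by rewrite z0 w0 addr0.
by rewrite zN wN opprD.
Qed.

Lemma alternatingZ f z : alternating z -> alternating (fun t => f * z t).
Proof. by move=> [z0 zN]; split=> *; rewrite ?z0 ?mulr0 // zN mulrN. Qed.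

Lemma wedgeZ g f z t : wedge g (fun s => f * z s) t = f * wedge g z t.
Proof.
elim: t z => [|a t IH] z /=; first by rewrite mulr0.
by rewrite IH mulrBr mulrCA.
Qed.

Lemma wedgeB g z w t : wedge g (fun s => z s - w s) t = wedge g z t - wedge g w t.
Proof.
elim: t z w => [|a t IH] z w /=; first by rewrite subr0.
by rewrite IH; ring.
Qed.

Lemma wedgeC g h z t : wedge g (wedge h z) t = - wedge h (wedge g z) t.
Proof.
elim: t z => [|a t IH] z /=; first by rewrite oppr0.
rewrite !wedgeB !wedgeZ IH; ring.
Qed.

Lemma kdiff_dirac a z t :
  kdiff (wedge (dirac a) z) t = 'X_a * z t - wedge (dirac a) (kdiff z) t.
Proof.
rewrite kdiff_wedge (bigD1 a) //= /dirac eqxx mulr1 big1 ?addr0 //.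
by move=> j /negPf ->; rewrite mulr0.
Qed.

(** The multiple of e_a e_b whose multidegree is (1, ..., 1).  In this
    multidegree the Koszul complex of S is the chain complex of a simplex, and
    in homological degree two the coefficient of a basis element lies in I iff
    the corresponding pair is an edge. *)
Definition edge_cochain a b : cochain := fun t =>
  mono K (~: [set a; b]) * wedge (dirac a) (wedge (dirac b) unit_cochain) t.

Definition triangle_cochain a b c : cochain := fun t =>
  mono K (~: [set a; b; c]) *
    wedge (dirac a) (wedge (dirac b) (wedge (dirac c) unit_cochain)) t.

Lemma kdiffZ f z t : kdiff (fun s => f * z s) t = f * kdiff z t.
Proof. by rewrite /kdiff mulr_sumr; apply: eq_bigr => j _; rewrite mulrCA. Qed.

Lemma kdiffD z w t : kdiff (fun s => z s + w s) t = kdiff z t + kdiff w t.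
Proof. by rewrite /kdiff -big_split; apply: eq_bigr => j _; rewrite mulrDr. Qed.

Lemma mono_setC1 W a : a \notin W -> mono K (~: W) = 'X_a * mono K (~: (a |: W)).
Proof.
move=> aW; rewrite (@mono_setD1 _ _ _ a) ?inE //; congr (_ * mono K _).
by apply/setP => i; rewrite !inE negb_or.
Qed.

Lemma kdiff_triangle a b c t : a != b -> a != c -> b != c ->
  kdiff (triangle_cochain a b c) t =
    edge_cochain b c t - edge_cochain a c t + edge_cochain a b t.
Proof.
move=> ab ac bc.
have unit0 s : kdiff unit_cochain s = 0.
  by rewrite /kdiff big1 // => j _; rewrite mulr0.
rewrite kdiffZ kdiff_dirac.
have -> : wedge (dirac a) (kdiff (wedge (dirac b) (wedge (dirac c) unit_cochain))) t =
   'X_b * wedge (dirac a) (wedge (dirac c) unit_cochain) t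
   - 'X_c * wedge (dirac a) (wedge (dirac b) unit_cochain) t.
  rewrite -!wedgeZ -wedgeB; apply: wedge_eq => s; rewrite kdiff_dirac; congr (_ - _).
  rewrite -wedgeZ; apply: wedge_eq => r; rewrite kdiff_dirac.
  by rewrite (@wedge_eq _ _ _ _ (fun=> 0)) // wedge0 subr0.
have na : a \notin [set b; c] by rewrite !inE negb_or ab.
have nb : b \notin [set a; c] by rewrite !inE negb_or eq_sym ab.
have nc : c \notin [set a; b] by rewrite !inE negb_or eq_sym ac eq_sym.
rewrite /edge_cochain (mono_setC1 na) (mono_setC1 nb) (mono_setC1 nc).
have -> : b |: [set a; c] = [set a; b; c] by apply/setP => i; rewrite !inE orbCA orbA.
have -> : c |: [set a; b] = [set a; b; c] by apply/setP => i; rewrite !inE orbC.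
rewrite setUA; ring.
Qed.

Fixpoint path_cochain b p : cochain := fun t =>
  if p is c :: p' then edge_cochain b c t + path_cochain c p' t else 0.

Fixpoint fan_cochain a b p : cochain := fun t =>
  if p is c :: p' then triangle_cochain a b c t + fan_cochain a c p' t else 0.

Lemma alternating_fan a b p : alternating (fan_cochain a b p).
Proof.
elim: p b => [|c p IH] b /=; first by split=> *; rewrite ?oppr0.
apply: alternatingD => //.
by apply: alternatingZ; do !apply: alternating_wedge; apply: alternating_unit.
Qed.

(** The fan from a over the path b, p: inner edges cancel. *)
Lemma kdiff_fan a b p t : uniq [:: a, b & p] ->
  kdiff (fan_cochain a b p) t =
    path_cochain b p t + edge_cochain a b t - edge_cochain a (last b p) t.
Proof.
elim: p b => [|c p IH] b U.
  by rewrite /= add0r subrr /kdiff big1 // => j _; rewrite mulr0.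
have [ab ac bc] : [/\ a != b, a != c & b != c].
  by move: U; rewrite /= !inE !negb_or -!andbA => /and5P[-> -> _ -> _].
rewrite /= kdiffD kdiff_triangle //.
rewrite IH; first by ring.
by move: U; rewrite /= !inE !negb_or => /and3P[/and3P[_ -> ->] _ ->].
Qed.

Lemma edge_cochain_eval a b (x y : 'I_n) : edge_cochain a b [:: x; y] =
  mono K (~: [set a; b]) * ((x == a)%:R * (y == b)%:R - (y == a)%:R * (x == b)%:R).
Proof. by rewrite /edge_cochain /= /dirac !mulr1 !subr0. Qed.

Lemma edge_cochainC a b t : edge_cochain a b t = - edge_cochain b a t.
Proof. by rewrite /edge_cochain wedgeC mulrN setUC. Qed.

(** The boundary of the fan over the cycle is the cycle itself, whose
    coefficients are generators of J.  If the fan were a boundary modulo J, its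
    differential would have coefficients in m J; these have degree at least
    n - 1, whereas the generators have degree n - 2. *)
Lemma cycle_koszul_class J (e : rel 'I_n) (cyc : seq 'I_n) :
  ideal_like J -> (forall i j, e i j -> J (mono K (~: [set i; j]))) ->
  (forall f, J f -> order_ge (n - 2) f) ->
  ucycle e cyc -> (2 < size cyc)%N -> koszul_class J 2.
Proof.
move=> idJ Je Jo; case: cyc => [|c0 [|c1 p]] // /andP[cyc U] szp.
have JE a b t : e a b -> J (edge_cochain a b t).
  by move=> /Je; apply: (ideal_likeMr idJ).
have kE x y : kdiff (fan_cochain c0 c1 p) [:: x; y] =
    path_cochain c1 p [:: x; y] + edge_cochain c0 c1 [:: x; y]
    - edge_cochain c0 (last c1 p) [:: x; y] by apply: kdiff_fan.
move: cyc; rewrite (cycle_path c0) /= => /and3P[el e01 pe].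
exists (fan_cochain c0 c1 p); split; first exact: alternating_fan.
  move=> t _; rewrite kdiff_fan // (edge_cochainC c0 (last _ _)) opprK.
  apply: ideal_likeD => //; last exact: JE.
  apply: ideal_likeD => //; last exact: JE.
  elim: p {szp U kE el} c1 pe {e01} => [|c p IH] c1 /=; first by move=> _; apply: ideal_like0.
  by move=> /andP[e1 pe]; apply: ideal_likeD => //; [apply: JE | apply: IH].
move=> [u [au Ju]].
(* the coefficient of the edge c0 c1 in the boundary of the fan *)
have Mo : order_ge (1 + (n - 2)) (mono K (~: [set c0; c1])).
  have <- : kdiff (fun t => fan_cochain c0 c1 p t - kdiff u t) [:: c0; c1]
      = mono K (~: [set c0; c1]).
    have -> : kdiff (fun t => fan_cochain c0 c1 p t - kdiff u t) [:: c0; c1]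
       = kdiff (fan_cochain c0 c1 p) [:: c0; c1] - kdiff (kdiff u) [:: c0; c1].
      by rewrite {1 2}/kdiff -sumrB; apply: eq_bigr => j _; rewrite mulrBr.
    rewrite kdiff_kdiff // subr0 kE.
    move: U; rewrite /= inE negb_or -!andbA => /and4P[n01 n0p n1p _].
    have l1 : last c1 p != c1.
      have : last c1 p \in p.
        by move: szp; case: (p) => // c q _ /=; apply: mem_last.
      by apply: contraTneq => ->.
    have path0 q b : c0 != b -> c0 \notin q -> path_cochain b q [:: c0; c1] = 0.
      elim: q b => //= c q IH b n0b.
      rewrite inE negb_or => /andP[n0c n0q]; rewrite (IH _ n0c n0q) addr0.
      by rewrite edge_cochain_eval (negPf n0b) (negPf n0c) mul0r mulr0 subrr mulr0.
    rewrite path0 //.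
    rewrite !edge_cochain_eval !eqxx (eq_sym c1 c0) (negPf n01) (eq_sym c1) (negPf l1) /=.
    by rewrite !mul0r !mulr0 !subr0 !mulr1 mulr0 subr0 add0r.
  apply: order_ge_sum => j; apply: order_geM; last by apply/Jo/Ju.
  by move=> m; rewrite msuppX inE => /eqP ->; rewrite mdeg1.
have := Mo (mesym1 (~: [set c0; c1])); rewrite monoE msuppX inE eqxx mdeg_mesym1.
move=> /(_ isT).
have := cardsC [set c0; c1]; rewrite card_ord cards2.
move: U; rewrite /= inE negb_or => /andP[/andP[-> _] _] /=.
by move: #|~: _| => k ek; rewrite -{1}ek subn2 /= add1n ltnn.
Qed.

End CycleClass.

(** * Comparison of minimal graded resolutions *)

Section GradedComponents.
Variables (n : nat) (K : fieldType).
Local Notation S := {mpoly K[n]}.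
Implicit Types (f g : S).

(** The shape of an entry of a degree-preserving matrix from a generator of
    degree k to one of degree l; written without a difference so that k < l
    forces f = 0. *)
Definition shom (k l : nat) f := forall m, m \in msupp f -> (mdeg m + l = k)%N.

(** The part of f that is allowed in such an entry. *)
Definition graded_part (k l : nat) f : S :=
  \sum_(m <- msupp f | (mdeg m + l)%N == k) f@_m *: 'X_[m].

Lemma mcoeff_graded_part k l f m :
  (graded_part k l f)@_m = if (mdeg m + l)%N == k then f@_m else 0.
Proof.
rewrite /graded_part raddf_sum /=.
under eq_bigr do rewrite mcoeffZ mcoeffX.
have [mf|nmf] := boolP (m \in msupp f); last first.
  have -> : f@_m = 0 by apply/eqP; rewrite mcoeff_eq0.
  rewrite if_same.
  rewrite big_seq_cond big1 // => m' /andP[m'f _].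
  by case: eqP => [e|_]; rewrite ?mulr0 //; rewrite -e m'f in nmf.
rewrite big_mkcond (bigD1_seq m) //= eqxx mulr1 big1 ?addr0 //.
by move=> m' /negPf ->; rewrite mulr0 if_same.
Qed.

Lemma shom_graded_part k l f : shom k l (graded_part k l f).
Proof.
by move=> m; rewrite mcoeff_msupp mcoeff_graded_part; case: ifP => [/eqP|]; rewrite ?eqxx.
Qed.

Lemma graded_part_id k l f : shom k l f -> graded_part k l f = f.
Proof.
move=> hf; apply/mpolyP => m; rewrite mcoeff_graded_part; case: eqP => // nm.
by apply/esym/eqP; rewrite mcoeff_eq0; apply/negP => /hf.
Qed.

Lemma graded_partD k l f g : graded_part k l (f + g) = graded_part k l f + graded_part k l g.
Proof.
apply/mpolyP => m; rewrite mcoeffD !mcoeff_graded_part mcoeffD.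
by case: ifP; rewrite ?addr0.
Qed.

Lemma graded_partN k l f : graded_part k l (- f) = - graded_part k l f.
Proof.
apply/mpolyP => m; rewrite mcoeffN !mcoeff_graded_part mcoeffN.
by case: ifP; rewrite ?oppr0.
Qed.

Lemma graded_part0 k l : graded_part k l 0 = 0.
Proof. by rewrite /graded_part msupp0 big_nil. Qed.

Lemma graded_part_sum k l (I : finType) (F : I -> S) :
  graded_part k l (\sum_i F i) = \sum_i graded_part k l (F i).
Proof.
by apply: (big_morph (graded_part k l)) => [f g|]; [apply: graded_partD | apply: graded_part0].
Qed.

Lemma graded_partM k l j f g : shom l j g -> graded_part k j (f * g) = graded_part k l f * g.
Proof.
move=> hg; apply/mpolyP => m; rewrite mcoeff_graded_part !mcoeffM.
have key (m1 m2 : 'X_{1..n}) : m = (m1 + m2)%MM ->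
    (graded_part k l f)@_m1 * g@_m2 = if (mdeg m + j == k)%N then f@_m1 * g@_m2 else 0.
  move=> ->; rewrite mcoeff_graded_part.
  have [g2|] := boolP (m2 \in msupp g); last first.
    by rewrite -mcoeff_eq0 => /eqP ->; rewrite !mulr0 if_same.
  by rewrite -(hg _ g2) addnA -mdegD; case: ifP; rewrite ?mul0r.
case: ifP => mk; last rewrite big1 //.
  by apply: eq_bigr => -[m1 m2] /= /eqP /key ->; rewrite mk.
by move=> [m1 m2] /= /eqP /key ->; rewrite mk.
Qed.

Lemma shomM k l j f g : shom k l f -> shom l j g -> shom k j (f * g).
Proof.
move=> hf hg m /msuppM_le /allpairsP [[m1 m2] [/= /hf <- /hg <- ->]].
by rewrite mdegD addnA.
Qed.

Lemma shom_const k l f : shom k l f -> f@_0%MM != 0 -> k = l.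
Proof. by rewrite -mcoeff_msupp => hf /hf; rewrite mdeg0. Qed.

Lemma ideal_of_graded_part (Q : S -> Prop) k f :
  (forall g, Q g -> exists l, shom l 0 g) -> ideal_of Q f -> ideal_of Q (graded_part k 0 f).
Proof.
move=> hQ; elim=> [|f' c g _ IH Qg]; first by rewrite graded_part0; left.
have [l hg] := hQ g Qg.
by rewrite graded_partD (graded_partM _ _ hg); apply: ideal_of_add.
Qed.

Definition graded_mx p q (dr : 'I_p -> nat) (dc : 'I_q -> nat) (A : 'M[S]_(p, q)) :=
  forall a b, shom (dr a) (dc b) (A a b).

Definition graded_part_mx p q (dr : 'I_p -> nat) (dc : 'I_q -> nat) (A : 'M[S]_(p, q)) :=
  \matrix_(a, b) graded_part (dr a) (dc b) (A a b).

Lemma graded_part_mx_graded p q (dr : 'I_p -> nat) (dc : 'I_q -> nat) A :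
  graded_mx dr dc (graded_part_mx dr dc A).
Proof. by move=> a b; rewrite mxE; apply: shom_graded_part. Qed.

Lemma graded_part_mx_id p q (dr : 'I_p -> nat) (dc : 'I_q -> nat) A :
  graded_mx dr dc A -> graded_part_mx dr dc A = A.
Proof. by move=> hA; apply/matrixP => a b; rewrite mxE graded_part_id. Qed.

Lemma graded_part_mulmx p q r (dr : 'I_p -> nat) (dq : 'I_q -> nat) (dc : 'I_r -> nat)
    (A : 'M_(p, q)) (B : 'M_(q, r)) :
  graded_mx dq dc B -> graded_part_mx dr dc (A *m B) = graded_part_mx dr dq A *m B.
Proof.
move=> hB; apply/matrixP => a c; rewrite !mxE graded_part_sum.
by apply: eq_bigr => b _; rewrite mxE; apply: graded_partM.
Qed.

Lemma graded_mulmx p q r (dr : 'I_p -> nat) (dq : 'I_q -> nat) (dc : 'I_r -> nat)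
    (A : 'M_(p, q)) (B : 'M_(q, r)) :
  graded_mx dr dq A -> graded_mx dq dc B -> graded_mx dr dc (A *m B).
Proof.
move=> hA hB; rewrite -[A](graded_part_mx_id hA) -(graded_part_mulmx dr A hB).
exact: graded_part_mx_graded.
Qed.

(** Choice of a row for each row of A. *)
Lemma mx_of_rows p q (P : 'rV[S]_q -> 'rV[S]_p -> Prop) r (A : 'M[S]_(r, p)) :
  (forall a, exists v, P v (row a A)) -> exists V : 'M_(r, q), forall a, P (row a V) (row a A).
Proof.
move=> ex; pose f a := proj1_sig (constructive_indefinite_description _ (ex a)).
exists (\matrix_a f a) => a; rewrite rowK.
exact: (proj2_sig (constructive_indefinite_description _ (ex a))).
Qed.

Lemma lift_mx p q r s (D : 'M[S]_(q, r)) (D' : 'M[S]_(p, q)) (A : 'M[S]_(s, q)) :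
  (forall u : 'rV_q, u *m D = 0 -> exists v, u = v *m D') ->
  A *m D = 0 -> exists V, A = V *m D'.
Proof.
move=> ex AD.
have [|V HV] := @mx_of_rows q p (fun v u => u = v *m D') s A.
  by move=> a; apply: ex; rewrite -row_mul AD linear0.
by exists V; apply/row_matrixP => a; rewrite row_mul HV.
Qed.

(** Any lift through a graded matrix can be replaced by its graded part. *)
Lemma graded_lift p q r (dp : 'I_p -> nat) (dq : 'I_q -> nat) (dr : 'I_r -> nat)
   (A : 'M[S]_(r, q)) (D' : 'M[S]_(p, q)) :
  graded_mx dp dq D' -> graded_mx dr dq A -> (exists V, A = V *m D') ->
  exists2 V, graded_mx dr dp V & A = V *m D'.
Proof.
move=> hD hA [V e]; exists (graded_part_mx dr dp V); first exact: graded_part_mx_graded.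
by rewrite -(graded_part_mulmx dr V hD) -e graded_part_mx_id.
Qed.

Lemma const_mulmx p q r (A : 'M[S]_(p, q)) (B : 'M[S]_(q, r)) a c :
  (forall a b, (A a b)@_0%MM = 0) \/ (forall a b, (B a b)@_0%MM = 0) ->
  ((A *m B) a c)@_0%MM = 0.
Proof.
move=> H; rewrite mxE raddf_sum /= big1 // => b _.
by rewrite rmorphM /=; case: H => ->; rewrite ?mul0r ?mulr0.
Qed.

End GradedComponents.

Section Comparison.
Variables (n : nat) (K : fieldType) (I : {mpoly K[n]} -> Prop).
Local Notation S := {mpoly K[n]}.
Hypotheses (idI : ideal_like I) (I_graded : forall k f, I f -> I (graded_part k 0 f)).
Variables E F : graded_maps n K.
Hypotheses (resE : minimal_graded_free_resolution I E)
           (resF : minimal_graded_free_resolution I F).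

Lemma diff_graded (G : graded_maps n K) i : minimal_graded_free_resolution I G ->
  graded_mx (@deg _ _ G i.+1) (@deg _ _ G i) (diff G i).
Proof.
case=> [[_ hd] _ _] a b m mi.
have [|le /dhomog_mf/(_ _ mi) /= ->] := hd i a b; last by rewrite subnK.
by apply: contraTneq mi => ->; rewrite msupp0.
Qed.

Lemma diff_exact (G : graded_maps n K) i s (A : 'M_(s, rk G i.+1)) :
  minimal_graded_free_resolution I G ->
  A *m diff G i = 0 -> exists V, A = V *m diff G i.+1.
Proof. by case=> _ [_ _ ex] _; apply: lift_mx => u /ex. Qed.

Lemma diff_exact0 (G : graded_maps n K) s (A : 'M_(s, rk G 0)) :
  minimal_graded_free_resolution I G ->
  (forall a, I ((A *m aug G) a 0)) -> exists V, A = V *m diff G 0.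
Proof.
case=> _ [_ ex _] _ IA.
have [|V HV] := @mx_of_rows n K _ _ (fun v u => u = v *m diff G 0) s A.
  by move=> a; apply/ex; rewrite -row_mul mxE.
by exists V; apply/row_matrixP => a; rewrite row_mul HV.
Qed.

Lemma diff_diff (G : graded_maps n K) i : minimal_graded_free_resolution I G ->
  diff G i.+1 *m diff G i = 0.
Proof.
case=> _ [_ _ ex] _; apply/row_matrixP => a; rewrite row_mul linear0; apply/ex.
by exists (delta_mx 0 a); rewrite -rowE.
Qed.

Lemma aug_diff (G : graded_maps n K) a : minimal_graded_free_resolution I G ->
  I ((diff G 0 *m aug G) a 0).
Proof.
case=> _ [_ ex _] _.
have -> : (diff G 0 *m aug G) a 0 = (row a (diff G 0) *m aug G) 0 0.
  by rewrite -row_mul [RHS]mxE.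
by apply/ex; exists (delta_mx 0 a); rewrite -rowE.
Qed.

Lemma aug_lift (G H : graded_maps n K) : minimal_graded_free_resolution I G ->
  minimal_graded_free_resolution I H ->
  exists A : 'M_(rk G 0, rk H 0), forall a, I ((A *m aug H - aug G) a 0).
Proof.
move=> _ [_ [[u Iu] _ _] _]; exists (aug G *m u) => a.
rewrite -mulmxA [u *m _]mx11_scalar mul_mx_scalar.
set x := (u *m _) 0 0 in Iu *; rewrite !mxE -/x.
have -> : x * aug G a 0 - aug G a 0 = - aug G a 0 * (1 - x) by ring.
exact: ideal_likeM.
Qed.

Lemma aug_graded (G : graded_maps n K) : minimal_graded_free_resolution I G ->
  graded_mx (@deg _ _ G 0) (fun=> 0%N) (aug G).
Proof.
case=> [[ha _] _ _] a b m; rewrite ord1 addn0.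
exact: (dhomog_mf (ha a)).
Qed.

(** Comparison maps f and g between E and F in two consecutive steps, and a
    homotopy from f g to the identity of E. *)
Definition homotopy_data i :=
  exists (f : 'M[S]_(rk E i, rk F i)) (f' : 'M[S]_(rk E i.+1, rk F i.+1))
         (g : 'M[S]_(rk F i, rk E i)) (g' : 'M[S]_(rk F i.+1, rk E i.+1))
         (h : 'M[S]_(rk E i, rk E i.+1)) (h' : 'M[S]_(rk E i.+1, rk E i.+2)),
  [/\ graded_mx (@deg _ _ E i) (@deg _ _ F i) f,
      graded_mx (@deg _ _ E i.+1) (@deg _ _ F i.+1) f',
      diff E i *m f = f' *m diff F i, diff F i *m g = g' *m diff E i &
      f' *m g' - 1%:M = diff E i *m h + h' *m diff E i.+1 /\
      (i = 0%N -> f *m g - 1%:M = h *m diff E i)].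

Lemma homotopy_data0 : homotopy_data 0.
Proof.
have [f0 If0] := aug_lift resE resF; have [g Ig] := aug_lift resF resE.
pose f := graded_part_mx (@deg _ _ E 0) (@deg _ _ F 0) f0.
have If a : I ((f *m aug F - aug E) a 0).
  have /(I_graded (deg a)) := If0 a.
  rewrite !mxE graded_partD graded_partN (@graded_part_id _ _ (deg a) 0 (aug E a 0)); last first.
    exact: aug_graded.
  rewrite graded_part_sum.
  under eq_bigr do rewrite (graded_partM _ _ (@aug_graded F resF _ _)).
  by under [in X in _ -> X]eq_bigr do rewrite mxE.
have hf : graded_mx (@deg _ _ E 0) (@deg _ _ F 0) f by apply: graded_part_mx_graded.
have Imul r s (A : 'M[S]_(r, s)) (v : 'cV_s) :
    (forall a, I (v a 0)) -> forall a, I ((A *m v) a 0).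
  by move=> Iv a; rewrite mxE; apply: ideal_like_sum => // b _; apply: ideal_likeM.
have lift01 (G H : graded_maps n K) (k : 'M_(rk G 0, rk H 0)) :
    minimal_graded_free_resolution I G -> minimal_graded_free_resolution I H ->
    (forall a, I ((k *m aug H - aug G) a 0)) ->
    exists V, diff G 0 *m k = V *m diff H 0.
  move=> resG resH Ik; apply: diff_exact0 => // a.
  have -> : diff G 0 *m k *m aug H = diff G 0 *m (k *m aug H - aug G) + diff G 0 *m aug G.
    by rewrite -mulmxDr subrK mulmxA.
  by rewrite mxE; apply: ideal_likeD => //; [apply: Imul | apply: aug_diff].
have [f' hf' ef] := graded_lift (diff_graded resF)
   (graded_mulmx (diff_graded resE) hf) (lift01 _ _ _ resE resF If).
have [g' eg] := lift01 _ _ _ resF resE Ig.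
have [h eh] : exists h, f *m g - 1%:M = h *m diff E 0.
  apply: diff_exact0 => // a.
  have -> : (f *m g - 1%:M) *m aug E = f *m (g *m aug E - aug F) + (f *m aug F - aug E).
    by rewrite mulmxBl mul1mx mulmxBr mulmxA addrA subrK.
  by rewrite mxE; apply: ideal_likeD => //; apply: Imul.
have [h' eh'] : exists h', f' *m g' - 1%:M - diff E 0 *m h = h' *m diff E 1.
  apply: diff_exact => //.
  rewrite !mulmxBl mul1mx -!mulmxA -eg -eh mulmxBr mulmx1 mulmxA -ef -mulmxA.
  by rewrite subrr.
exists f, f', g, g', h, h'; split=> //; split=> //.
by rewrite -eh' [RHS]addrC subrK.
Qed.

Lemma homotopy_dataS i : homotopy_data i -> homotopy_data i.+1.
Proof.
move=> [f [f' [g [g' [h [h' [hf hf' ef eg [eh _]]]]]]]].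
have [f'' hf'' ef'] : exists2 V, graded_mx (@deg _ _ E i.+2) (@deg _ _ F i.+2) V &
    diff E i.+1 *m f' = V *m diff F i.+1.
  apply: (graded_lift (diff_graded resF)).
    exact: graded_mulmx (diff_graded resE) hf'.
  by apply: diff_exact => //; rewrite -mulmxA -ef mulmxA diff_diff // mul0mx.
have [g'' eg'] : exists V, diff F i.+1 *m g' = V *m diff E i.+1.
  by apply: diff_exact => //; rewrite -mulmxA -eg mulmxA diff_diff // mul0mx.
have [h'' eh'] : exists h'', f'' *m g'' - 1%:M - diff E i.+1 *m h' = h'' *m diff E i.+2.
  apply: diff_exact => //.
  rewrite !mulmxBl mul1mx -!mulmxA -eg' (mulmxA f'') -ef' -mulmxA -{2}[diff E i.+1]mulmx1.
  rewrite -!mulmxBr.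
  have -> : f' *m g' - 1%:M - h' *m diff E i.+1 = diff E i *m h by rewrite eh addrK.
  by rewrite mulmxA diff_diff // mul0mx.
exists f', f'', g', g'', h', h''; split=> //; split=> //.
by rewrite -eh' [RHS]addrC subrK.
Qed.

(** By minimality f g is the identity modulo m.  So for each generator a some
    entry f a b has a nonzero constant term, and f is graded. *)
Lemma resolution_degrees i (a : 'I_(rk E i)) : exists b : 'I_(rk F i), deg b = deg a.
Proof.
have [f [g [hf fg]]] : exists (f : 'M[S]_(rk E i, rk F i)) (g : 'M[S]_(rk F i, rk E i)),
    graded_mx (@deg _ _ E i) (@deg _ _ F i) f /\ ((f *m g) a a)@_0%MM = 1.
  have minE j : forall a b, (diff E j a b)@_0%MM = 0 by case: resE => _ _; apply.
  have one r (x : 'I_r) : ((1%:M : 'M[S]_r) x x)@_0%MM = 1 by rewrite mxE eqxx mcoeff1 eqxx.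
  case: i a => [|i] a.
    have [f [_ [g [_ [h [_ [hf _ _ _ [_ /(_ erefl) e]]]]]]]] := homotopy_data0.
    exists f, g; split=> //; rewrite -(subrK 1%:M (f *m g)) e mxE mcoeffD one.
    by rewrite const_mulmx ?add0r //; right.
  have [f [f' [g [g' [h [h' [_ hf' _ _ [e _]]]]]]]] : homotopy_data i.
    by elim: (i) => [|j]; [apply: homotopy_data0 | apply: homotopy_dataS].
  exists f', g'; split=> //; rewrite -(subrK 1%:M (f' *m g')) e.
  rewrite 2!mxE !mcoeffD one !const_mulmx ?add0r //; first by right.
  by left.
have [b nz] : exists b, (f a b * g b a)@_0%MM != 0.
  apply/existsP; apply: contraT; rewrite negb_exists => /forallP z.
  move: fg; rewrite mxE raddf_sum /= big1 => [/esym/eqP|b _]; first by rewrite oner_eq0.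
  by apply/eqP; move: (z b); rewrite negbK.
exists b; apply/esym/(shom_const (hf a b)).
by apply: contra nz => /eqP e; rewrite rmorphM /= e mul0r.
Qed.

End Comparison.

(** * Resolutions of length three and mapping cones *)

Section ShortResolutions.
Variables (n : nat) (K : fieldType).
Local Notation S := {mpoly K[n]}.
Implicit Types (Q I : S -> Prop) (f g q : S).

Definition const0_mx p r (A : 'M[S]_(p, r)) := forall a b, (A a b)@_0%MM = 0.

(** A minimal graded free resolution of the module I, whose generators all have
    degree s.  For s > 0 it is that of S/I with its step 0 removed; s = 0 occurs
    for I = S, where the inductions below start. *)
Record short_res I (s r1 r2 r3 : nat) (d2 : 'I_r2 -> nat) (d3 : 'I_r3 -> nat)
    (G : 'M[S]_(r1, 1)) (D1 : 'M[S]_(r2, r1)) (D2 : 'M[S]_(r3, r2)) : Prop := ShortRes {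
  sr_gens : forall f, I f <-> exists u : 'rV_r1, f = (u *m G) 0 0;
  sr_cx1 : D1 *m G = 0;
  sr_ex1 : forall u : 'rV_r1, u *m G = 0 -> exists v, u = v *m D1;
  sr_cx2 : D2 *m D1 = 0;
  sr_ex2 : forall u : 'rV_r2, u *m D1 = 0 -> exists v, u = v *m D2;
  sr_inj : forall u : 'rV_r3, u *m D2 = 0 -> u = 0;
  sr_deg0 : graded_mx (fun=> s) (fun=> 0%N) G;
  sr_deg1 : graded_mx d2 (fun=> s) D1;
  sr_deg2 : graded_mx d3 d2 D2;
  sr_min1 : const0_mx D1;
  sr_min2 : const0_mx D2 }.

Lemma short_res_ext I I' s r1 r2 r3 d2 d3 G D1 D2 : (forall f, I f <-> I' f) ->
  @short_res I s r1 r2 r3 d2 d3 G D1 D2 -> short_res I' s d2 d3 G D1 D2.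
Proof. by move=> eqI [H *]; split=> // f; split=> [/eqI/H|/H/eqI]. Qed.

Definition no_degree (i : 'I_0) : nat := 0.

Lemma mx11P (A : 'M[S]_1) : A 0 0 = 0 -> A = 0.
Proof. by move=> A0; rewrite [A]mx11_scalar A0 raddf0. Qed.

Lemma short_res_principal Q m s : m != 0 -> shom s 0 m -> (forall f, Q f <-> f = m) ->
  short_res (ideal_of Q) s no_degree no_degree (m%:M : 'M_1) (0 : 'M_(0, 1)) (0 : 'M_(0, 0)).
Proof.
move=> m0 hm Qm; split=> //; try by case.
- move=> f; split.
    apply: (@ideal_of_min _ _ _ (fun f => exists u : 'rV_1, f = (u *m m%:M) 0 0)).
      split; first by exists 0; rewrite mul0mx mxE.
      + by move=> _ _ [u ->] [v ->]; exists (u + v); rewrite mulmxDl [RHS]mxE.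
      + by move=> c _ [u ->]; exists (c *: u); rewrite -scalemxAl [RHS]mxE.
    by move=> g /Qm ->; exists 1%:M; rewrite mul1mx mxE eqxx.
  move=> [u ->]; rewrite mul_mx_scalar mxE mulrC; apply: ideal_likeM.
    exact: ideal_of_ideal.
  exact/ideal_of_mem/Qm.
- exact: mul0mx.
- move=> u; rewrite mul_mx_scalar => /matrixP/(_ 0 0); rewrite !mxE => /eqP.
  rewrite mulf_eq0 (negPf m0) /= => /eqP/mx11P ->; exists 0.
  by rewrite mul0mx.
- exact: mul0mx.
- by move=> u _; exists 0; rewrite [LHS]thinmx0 [RHS]thinmx0.
- by move=> u _; apply: thinmx0.
- by move=> a b; rewrite !ord1 mxE.
Qed.

Definition cat_degree p r (d : 'I_p -> nat) (d' : 'I_r -> nat) (i : 'I_(p + r)) : nat :=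
  match split i with inl j => d j | inr j => d' j end.

Lemma cat_degreel p r d d' i : @cat_degree p r d d' (lshift r i) = d i.
Proof. by rewrite /cat_degree (unsplitK (inl i)). Qed.
Lemma cat_degreer p r d d' i : @cat_degree p r d d' (rshift p i) = d' i.
Proof. by rewrite /cat_degree (unsplitK (inr i)). Qed.

Lemma row_mx_ind p r1 r2 (P : 'I_p -> 'I_(r1 + r2) -> S -> Prop)
    (A : 'M[S]_(p, r1)) (B : 'M[S]_(p, r2)) :
  (forall a b, P a (lshift r2 b) (A a b)) -> (forall a b, P a (rshift r1 b) (B a b)) ->
  forall a b, P a b (row_mx A B a b).
Proof.
move=> PA PB a b; case: (split_ordP b) => j ->; first by rewrite row_mxEl.
by rewrite row_mxEr.
Qed.

Lemma col_mx_ind p r1 r2 (P : 'I_(r1 + r2) -> 'I_p -> S -> Prop)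
    (A : 'M[S]_(r1, p)) (B : 'M[S]_(r2, p)) :
  (forall a b, P (lshift r2 a) b (A a b)) -> (forall a b, P (rshift r1 a) b (B a b)) ->
  forall a b, P a b (col_mx A B a b).
Proof.
move=> PA PB a b; case: (split_ordP a) => j ->; first by rewrite col_mxEu.
by rewrite col_mxEd.
Qed.

Lemma graded_row_mx p r1 r2 dr dc (A : 'M[S]_(p, r1)) (B : 'M[S]_(p, r2)) :
  graded_mx dr (fun j => dc (lshift r2 j)) A -> graded_mx dr (fun j => dc (rshift r1 j)) B ->
  graded_mx dr dc (row_mx A B).
Proof. exact: (@row_mx_ind _ _ _ (fun i j => shom (dr i) (dc j))). Qed.

Lemma graded_col_mx p r1 r2 dr dc (A : 'M[S]_(r1, p)) (B : 'M[S]_(r2, p)) :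
  graded_mx (fun i => dr (lshift r2 i)) dc A -> graded_mx (fun i => dr (rshift r1 i)) dc B ->
  graded_mx dr dc (col_mx A B).
Proof. exact: (@col_mx_ind _ _ _ (fun i j => shom (dr i) (dc j))). Qed.

Lemma const0_row_mx p r1 r2 (A : 'M[S]_(p, r1)) (B : 'M[S]_(p, r2)) :
  const0_mx A -> const0_mx B -> const0_mx (row_mx A B).
Proof. exact: (@row_mx_ind _ _ _ (fun _ _ f => f@_0%MM = 0)). Qed.

Lemma const0_col_mx p r1 r2 (A : 'M[S]_(r1, p)) (B : 'M[S]_(r2, p)) :
  const0_mx A -> const0_mx B -> const0_mx (col_mx A B).
Proof. exact: (@col_mx_ind _ _ _ (fun _ _ f => f@_0%MM = 0)). Qed.

Lemma const0_0mx p r : const0_mx (0 : 'M_(p, r)).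
Proof. by move=> a b; rewrite mxE mcoeff0. Qed.

Lemma const0N p r (A : 'M_(p, r)) : const0_mx A -> const0_mx (- A).
Proof. by move=> A0 a b; rewrite mxE mcoeffN A0 oppr0. Qed.

Lemma shom0 k l : shom k l (0 : S).
Proof. by move=> m; rewrite msupp0. Qed.

Lemma shom_shift k l j f : shom k l f -> shom (k + j) (l + j) f.
Proof. by move=> hf m /hf <-; rewrite addnA. Qed.

Lemma shomN k l f : shom k l f -> shom k l (- f).
Proof. by move=> hf m; rewrite (perm_mem (msuppN _)) => /hf. Qed.

Lemma scalar_mx_entry p (q : S) (a b : 'I_p) : (q%:M : 'M_p) a b = q *+ (a == b).
Proof. by rewrite mxE. Qed.

(** The mapping cone of the inclusion B -> A covered by f1 and f2, for the link
    q A + B; here S/B has a resolution of length two.  In terms of generators: a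
    generator of B lies in A, so q b has two expressions. *)
Section Cone.
Variables (QA QB : S -> Prop) (q : S) (delta : nat).
Variables (sA r1A r2A r3A : nat) (d2A : 'I_r2A -> nat) (d3A : 'I_r3A -> nat).
Variables (GA : 'M[S]_(r1A, 1)) (D1A : 'M[S]_(r2A, r1A)) (D2A : 'M[S]_(r3A, r2A)).
Variables (r1B r2B : nat) (d2B : 'I_r2B -> nat).
Variables (GB : 'M[S]_(r1B, 1)) (D1B : 'M[S]_(r2B, r1B)).
Hypotheses (resA : short_res (ideal_of QA) sA d2A d3A GA D1A D2A)
  (resB : short_res (ideal_of QB) (sA + delta) d2B no_degree GB D1B (0 : 'M_(0, r2B))).
Hypotheses (q_neq0 : q != 0) (q_hom : shom delta 0 q) (delta_gt0 : (0 < delta)%N)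
  (q_reg : regular_mod (ideal_of QB) q) (BA : forall f, QB f -> ideal_of QA f)
  (d2AB : forall a b, (d2A b < d2B a)%N).

Definition cone_deg2 : 'I_(r2A + (r2B + r1B)) -> nat :=
  cat_degree (fun a => d2A a + delta)%N
    (cat_degree d2B (fun=> sA + delta + delta)%N).

Definition cone_deg3 : 'I_(r3A + r2B) -> nat :=
  cat_degree (fun a => d3A a + delta)%N (fun a => d2B a + delta)%N.

Lemma injB (u : 'rV_r2B) : u *m D1B = 0 -> u = 0.
Proof. by move=> /(sr_ex2 resB) [v ->]; rewrite mulmx0. Qed.

(** A relation q a + b = 0 with a in A and b in B forces a in B, since q is
    regular modulo B; this is where the third block of rows of D1 comes from. *)
Lemma short_res_cone : exists G D1 D2,
  @short_res (ideal_of (link q QA QB)) (sA + delta) (r1A + r1B) _ _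
    cone_deg2 cone_deg3 G D1 D2.
Proof.
have idA := ideal_of_ideal QA; have idB := ideal_of_ideal QB.
have entryB (u : 'rV_r1B) : ideal_of QB ((u *m GB) 0 0) by apply/(sr_gens resB); exists u.
have [f1 hf1 ef1] : exists2 f1 : 'M_(r1B, r1A),
    graded_mx (fun=> sA + delta)%N (fun=> sA) f1 & GB = f1 *m GA.
  apply: (graded_lift (sr_deg0 resA) (sr_deg0 resB)).
  have [|V HV] := @mx_of_rows n K _ _ (fun v u => u = v *m GA) _ GB.
    move=> a; have : ideal_of QA ((row a GB) 0 0).
      by apply: (ideal_of_sub BA); rewrite rowE; apply: entryB.
    move=> /(sr_gens resA) [u e]; exists u; apply/matrixP => i j.
    by rewrite !ord1.
  by exists V; apply/row_matrixP => a; rewrite row_mul HV.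
have [f2 hf2 ef2] : exists2 f2 : 'M_(r2B, r2A), graded_mx d2B d2A f2 & D1B *m f1 = f2 *m D1A.
  apply: (graded_lift (sr_deg1 resA)).
    exact: graded_mulmx (sr_deg1 resB) hf1.
  apply: lift_mx (sr_ex1 resA) _.
  by rewrite -mulmxA -ef1 (sr_cx1 resB).
have q0 : q@_0%MM = 0.
  apply/eqP; apply: contraTT delta_gt0 => /(shom_const q_hom) ->.
  by rewrite ltnn.
have qN r : const0_mx (q%:M : 'M_r).
  by move=> a b; rewrite scalar_mx_entry mcoeffMn q0 mul0rn.
have f10 a b : (f1 a b)@_0%MM = 0.
  apply/eqP; apply: contraTT delta_gt0 => /(shom_const (hf1 a b))/eqP.
  by rewrite -{2}[sA]addn0 eqn_add2l => /eqP ->.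
have f20 a b : (f2 a b)@_0%MM = 0.
  by apply/eqP; apply: contraTT (d2AB a b) => /(shom_const (hf2 a b)) ->; rewrite ltnn.
have cancelq p (v : 'rV[S]_p) : q *: v = 0 -> v = 0.
  move=> /matrixP e; apply/matrixP => i j; apply/eqP.
  by have /eqP := e i j; rewrite !mxE mulf_eq0 (negPf q_neq0).
(* Rows of D1: syzygies of A, syzygies of B, and q GB = f1 (q GA). *)
pose G := col_mx (q *: GA) GB.
pose D1 := col_mx (row_mx D1A 0) (col_mx (row_mx 0 D1B) (row_mx f1 (- q%:M))).
pose D2 := col_mx (row_mx D2A 0) (row_mx (- f2) (row_mx q%:M D1B)).
exists G, D1, D2; split.
- move=> f; split.
    move=> /ideal_of_link [a [b [/(sr_gens resA) [u ->] /(sr_gens resB) [v ->] ->]]].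
    by exists (row_mx u v); rewrite mul_row_col -scalemxAr [RHS]mxE [X in _ = X + _]mxE.
  move=> [u ->]; rewrite -[u]hsubmxK mul_row_col -scalemxAr mxE [X in X + _]mxE.
  apply/ideal_of_link; exists ((lsubmx u *m GA) 0 0), ((rsubmx u *m GB) 0 0).
  by split=> //; apply/(sr_gens resA); exists (lsubmx u).
- rewrite !mul_col_mx !mul_row_col !mul0mx addr0 add0r -!scalemxAr (sr_cx1 resA) scaler0.
  by rewrite (sr_cx1 resB) mulNmx mul_scalar_mx -ef1 subrr !col_mx0.
- move=> u; rewrite -[u]hsubmxK; set u1 := lsubmx u; set u2 := rsubmx u.
  rewrite mul_row_col -scalemxAr => e.
  have [w ew] : exists w : 'rV_r1B, (u1 *m GA) 0 0 = (w *m GB) 0 0.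
    apply/(sr_gens resB)/q_reg.
    have /matrixP/(_ 0 0) := e; rewrite mxE [X in X + _]mxE [RHS]mxE => /eqP.
    by rewrite addr_eq0 => /eqP ->; apply: ideal_likeN.
  have {}ew : u1 *m GA = w *m GB by apply/matrixP => i j; rewrite !ord1.
  have [x ex] : exists x, u1 - w *m f1 = x *m D1A.
    by apply: (sr_ex1 resA); rewrite mulmxBl ew -mulmxA -ef1 subrr.
  have [y ey] : exists y, q *: w + u2 = y *m D1B.
    by apply: (sr_ex1 resB); rewrite mulmxDl -scalemxAl -ew.
  exists (row_mx x (row_mx y w)).
  rewrite !mul_row_col !mul_mx_row !mulmx0 -ex -ey !add_row_mx !add0r.
  by rewrite subrK mulmxN mul_mx_scalar addrC addrA addNr add0r.
- rewrite !mul_col_mx !mul_row_col !mul_mx_row !mulmx0 !mul0mx (sr_cx2 resA) !addr0.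
  rewrite !add_row_mx !add0r mulNmx ef2 addNr mulmxN mul_mx_scalar mul_scalar_mx.
  by rewrite subrr ?row_mx0 ?col_mx0.
- move=> u; rewrite -[u]hsubmxK -[rsubmx u]hsubmxK.
  set x := lsubmx u; set y := lsubmx _; set z := rsubmx _.
  rewrite !mul_row_col !mul_mx_row !mulmx0 !add_row_mx !add0r -[0]row_mx0.
  move=> /eq_row_mx [e1 e2].
  have {}e2 : y *m D1B = q *: z.
    by move: e2; rewrite mulmxN mul_mx_scalar => /eqP; rewrite subr_eq0 => /eqP.
  have [t et] : exists t, z = t *m D1B.
    apply: (sr_ex1 resB); apply: cancelq.
    by rewrite scalemxAl -e2 -mulmxA (sr_cx1 resB) mulmx0.
  have ey : y = q *: t.
    by apply/eqP; rewrite -subr_eq0; apply/eqP/injB; rewrite mulmxBl e2 et -scalemxAl subrr.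
  have [v ev] : exists v, x + t *m f2 = v *m D2A.
    by apply: (sr_ex2 resA); rewrite mulmxDl -mulmxA -ef2 mulmxA -et.
  exists (row_mx v t); rewrite !mul_row_col !mul_mx_row mulmx0 add_row_mx add0r -ev.
  by rewrite mulmxN addrK mul_mx_scalar -ey -et.
- move=> u; rewrite -[u]hsubmxK; set x := lsubmx u; set t := rsubmx u.
  rewrite mul_row_col !mul_mx_row mulmx0 add_row_mx add0r -[0]row_mx0 => /eq_row_mx [e1].
  rewrite -[0]row_mx0 => /eq_row_mx [e2 _].
  have t0 : t = 0 by apply: cancelq; rewrite -mul_mx_scalar.
  move: e1; rewrite t0 mul0mx addr0 => /(sr_inj resA) ->.
  by rewrite row_mx0.
- apply: graded_col_mx => a b; last exact: (sr_deg0 resB).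
  rewrite mxE addnC; apply: (@shomM _ _ _ sA); [exact: (shom_shift sA q_hom) |].
  exact: (sr_deg0 resA).
- apply: graded_col_mx; last apply: graded_col_mx; apply: graded_row_mx => a b;
    rewrite /cone_deg2 ?(cat_degreel, cat_degreer);
    rewrite ?[(0 : 'M_(_, _)) _ _]mxE; try exact: shom0.
  + apply: shom_shift; exact: (sr_deg1 resA).
  + exact: (sr_deg1 resB).
  + by apply: shom_shift; apply: hf1.
  + rewrite mxE scalar_mx_entry; apply: shomN; case: (a == b); last exact: shom0.
    by rewrite [(_ + delta)%N]addnC; exact: (shom_shift _ q_hom).
- apply: graded_col_mx; apply: graded_row_mx; last apply: graded_row_mx; move=> a b;
    rewrite /cone_deg2 /cone_deg3 ?(cat_degreel, cat_degreer);
    rewrite ?[(0 : 'M_(_, _)) _ _]mxE; try exact: shom0.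
  + apply: shom_shift; exact: (sr_deg2 resA).
  + by rewrite mxE; apply: shomN; apply: shom_shift; exact: hf2.
  + rewrite scalar_mx_entry; case: eqP => [->|_]; last exact: shom0.
    by rewrite addnC; exact: (shom_shift _ q_hom).
  + apply: shom_shift; exact: (sr_deg1 resB).
- apply: const0_col_mx; last apply: const0_col_mx; apply: const0_row_mx;
    [exact: (sr_min1 resA) | exact: const0_0mx | exact: const0_0mx | exact: sr_min1 resB
    | exact: f10 | exact/const0N/qN].
- apply: const0_col_mx; apply: const0_row_mx;
    [exact: (sr_min2 resA) | exact: const0_0mx | exact/const0N/f20
    | apply: const0_row_mx; [exact: qN | exact: (sr_min1 resB)]].
Qed.

End Cone.
End ShortResolutions.

Section Assembly.
Variables (n : nat) (K : fieldType).
Local Notation S := {mpoly K[n]}.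
Implicit Types (Q I : S -> Prop) (f g q : S).

Definition resolution_maps s r1 r2 r3 (d2 : 'I_r2 -> nat) (d3 : 'I_r3 -> nat)
    (G : 'M[S]_(r1, 1)) (D1 : 'M[S]_(r2, r1)) (D2 : 'M[S]_(r3, r2)) : graded_maps n K :=
  let rk i := match i with 0 => 1 | 1 => r1 | 2 => r2 | 3 => r3 | _ => 0 end in
  @GradedMaps n K rk
    (fun i => match i return 'I_(rk i) -> nat with
      0 => fun=> 0 | 1 => fun=> s | 2 => d2 | 3 => d3 | _ => fun=> 0 end)
    (fun i => match i return 'M_(rk i.+1, rk i) with
      0 => G | 1 => D1 | 2 => D2 | _ => 0 end)
    1%:M.

Lemma resolution_maps_minimal I s r1 r2 r3 d2 d3 G D1 D2 :
  ideal_like I -> (0 < s)%N -> @short_res n K I s r1 r2 r3 d2 d3 G D1 D2 ->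
  minimal_graded_free_resolution I (resolution_maps s d2 d3 G D1 D2).
Proof.
move=> idI s0 [gens cx1 ex1 cx2 ex2 inj h0 h1 h2 m1 m2].
have homE k l f : shom k l f -> f != 0 -> (l <= k)%N /\ f \is (k - l).-homog.
  move=> hf f0; have : msupp f != [::] by rewrite msupp_eq0.
  case e: (msupp f) => [|m ms] // _; split.
    by rewrite -(hf m) ?leq_addl // e mem_head.
  by apply/dhomogP => m' /hf <-; rewrite addnK.
split.
- split=> [a|[|[|[|i]]] a b] /=.
  + by rewrite !ord1 mxE eqxx; apply: dhomog1.
  + exact/homE/h0.
  + exact/homE/h1.
  + exact/homE/h2.
  + by case: a.
- split.
  + exists 1%:M; rewrite mul1mx /= mxE eqxx subrr; exact: ideal_like0.
  + move=> u; rewrite mulmx1; split.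
      move=> /gens [v e]; exists v; apply/matrixP => i j; rewrite !ord1 e.
      by [].
    by move=> [v ->]; apply/gens; exists v.
  + case=> [|[|[|i]]] u /=.
    * by split=> [/ex1|[v ->]] //; rewrite -mulmxA cx1 mulmx0.
    * by split=> [/ex2|[v ->]] //; rewrite -mulmxA cx2 mulmx0.
    * by split=> [/inj ->|[v ->]]; [exists 0; rewrite mul0mx | rewrite mulmx0 mul0mx].
    * by split=> _; [exists 0; rewrite [LHS]thinmx0 [RHS]thinmx0 | rewrite mulmx0].
- case=> [|[|[|i]]] a b /=; [|exact: m1|exact: m2|by case: a].
  apply/eqP; apply: contraTT s0 => /(shom_const (h0 a b)) /= ->.
  by rewrite ltnn.
Qed.

Lemma short_res_no_third I s r1 r2 (d2 : 'I_r2 -> nat) (d3 : 'I_0 -> nat)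
    G D1 (D2 : 'M_(0, r2)) :
  @short_res n K I s r1 r2 0 d2 d3 G D1 D2 ->
  @short_res n K I s r1 r2 0 d2 no_degree G D1 0.
Proof.
case=> [gens cx1 ex1 cx2 ex2 inj h0 h1 h2 m1 m2].
have D20 : D2 = 0 by apply: flatmx0.
by subst D2; split=> // -[].
Qed.

End Assembly.

(** * Links between edge ideals *)

Section LinkSteps.
Variables (n : nat) (K : fieldType).
Local Notation S := {mpoly K[n]}.
Implicit Types (Q I : S -> Prop) (f g q : S) (W C : {set 'I_n}) (e : rel 'I_n).

Definition edge_gens e W : S -> Prop := fun g =>
  exists i j, [/\ i \in W, j \in W, e i j & g = mono K (W :\: [set i; j])].

(** Generators of the complementary edge ideal of a star with leaves W and a
    centre outside of W. *)
Definition star_gens W : S -> Prop := fun g => exists2 i, i \in W & g = mono K (W :\ i).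

Lemma complementary_edge_idealE e f :
  complementary_edge_ideal K e f <-> ideal_of (edge_gens e setT) f.
Proof.
rewrite /complementary_edge_ideal; set gs := [seq _ | _ <- _].
have gsE g : g \in gs <-> edge_gens e setT g.
  have prodE i j : \prod_(k < n | (k != i) && (k != j)) 'X_k = mono K (setT :\: [set i; j]).
    by apply: eq_bigl => k; rewrite !inE negb_or andbT.
  split=> [/mapP [[i j]]|[i [j [_ _ eij ->]]]].
    by rewrite mem_enum => eij ->; exists i, j; rewrite prodE.
  by apply/mapP; exists (i, j); rewrite ?mem_enum // prodE.
split.
  move=> [c ->]; apply: ideal_like_sum => [|i _]; first exact: ideal_of_ideal.
  apply: ideal_likeM; first exact: ideal_of_ideal.
  by apply/ideal_of_mem/gsE/mem_nth.
apply: ideal_of_min; first split.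
- by exists (fun=> 0); rewrite big1 // => i _; rewrite mul0r.
- move=> _ _ [c ->] [d ->]; exists (fun i => c i + d i).
  by rewrite -big_split; apply: eq_bigr => i _; rewrite mulrDl.
- move=> x _ [c ->]; exists (fun i => x * c i).
  by rewrite mulr_sumr; apply: eq_bigr => i _; rewrite mulrA.
move=> g /gsE gin; exists (fun i => (i == index g gs)%:R).
have lt : (index g gs < size gs)%N by rewrite index_mem.
rewrite (bigD1 (Ordinal lt)) //= eqxx mul1r nth_index // big1 ?addr0 //.
by move=> i /negPf ni; rewrite -[(i : nat) == _]/(i == Ordinal lt) ni mul0r.
Qed.

Lemma mono_setU1 v W : v \notin W -> mono K (v |: W) = 'X_v * mono K W.
Proof. by move=> vW; rewrite (mono_setD1 K (setU11 v W)) setU1K. Qed.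

Lemma regular_varQ Q v :
  (forall g, Q g -> exists2 W : {set 'I_n}, v \notin W & g = mono K W) ->
  regular_mod (ideal_of Q) 'X_v.
Proof.
move=> QW; apply: regular_var => g /QW [W vW ->]; apply: kill_mono.
by rewrite disjoints1.
Qed.

Lemma star_gens_var W v : v \notin W -> regular_mod (ideal_of (star_gens W)) 'X_v.
Proof.
move=> vW; apply: regular_varQ => g [i iW ->]; exists (W :\ i) => //.
by rewrite inE negb_and vW orbT.
Qed.

Lemma single_gen_var W v : v \notin W -> regular_mod (ideal_of (eq (mono K W))) 'X_v.
Proof. by move=> vW; apply: regular_varQ => g <-; exists W. Qed.

(** The edges that do not meet the new vertex v contribute multiples of x_v, the
    edges vw contribute x_{W - w}. *)
Lemma edge_gens_setU1 e W v g : ssrbool.symmetric e -> irreflexive e -> v \notin W ->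
  edge_gens e (v |: W) g <->
  link 'X_v (edge_gens e W) (fun h => exists w, [/\ w \in W, e v w & h = mono K (W :\ w)]) g.
Proof.
move=> sym irr vW.
have vj j : v \in W :\: [set v; j] = false by rewrite !inE eqxx.
have setE j : (v |: W) :\: [set v; j] = W :\ j.
  apply/setP => k; rewrite !inE negb_or; have [->|] := eqVneq k v => //=.
  by rewrite (negPf vW) andbF.
have setE2 i j : i \in W -> j \in W -> (v |: W) :\: [set i; j] = v |: (W :\: [set i; j]).
  move=> iW jW; apply/setP => k; rewrite !inE negb_or; have [->|] := eqVneq k v => //=.
  by rewrite !(contraNneq _ vW) // => ->.
have nv i j : v \notin W :\: [set i; j] by rewrite inE negb_and vW orbT.
split.
  move=> [i [j [/setU1P[->|iW] /setU1P[->|jW] eij ->]]].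
  - by rewrite irr in eij.
  - by right; exists j; rewrite setE.
  - by right; exists i; rewrite (setUC [set i]) setE sym.
  - by left; exists (mono K (W :\: [set i; j])); [exists i, j | rewrite setE2 // mono_setU1].
move=> [[h [i [j [iW jW eij ->]]] ->]|[w [wW ew ->]]].
  by exists i, j; rewrite setE2 // mono_setU1 // !inE iW jW !orbT.
by exists v, w; rewrite setE !inE eqxx wW orbT.
Qed.

Lemma edge_gens_setU2 e W u v g : ssrbool.symmetric e -> irreflexive e ->
  u \notin W -> v \notin W -> e u v -> (forall x y, x \in W -> e x y -> y \in W) ->
  edge_gens e (u |: (v |: W)) g <-> link ('X_u * 'X_v) (edge_gens e W) (eq (mono K W)) g.
Proof.
move=> sym irr uW vW euv clW.
have uv : u != v by apply: contraTneq euv => ->; rewrite irr.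
have uvW : u \notin v |: W by rewrite !inE negb_or uv.
have uW' w : w \in W -> e u w = false.
  by move=> wW; apply: contraNF uW => euw; apply: (clW w) => //; rewrite sym.
have vW' w : w \in W -> e v w = false.
  by move=> wW; apply: contraNF vW => evw; apply: (clW w) => //; rewrite sym.
have vWK : (v |: W) :\ v = W by rewrite setU1K.
split.
  move=> /(edge_gens_setU1 _ sym irr uvW) [[h /(edge_gens_setU1 _ sym irr vW)]|].
    move=> [[h' Eh' ->] ->|[w [wW evw]]]; last by rewrite vW' in evw.
    by left; exists h'; rewrite // mulrA.
  move=> [w [/setU1P[->|wW] euw ->]]; last by rewrite uW' in euw.
  by right; rewrite vWK.
move=> H; apply/(edge_gens_setU1 _ sym irr uvW).
case: H => [[h Eh ->]|<-].
  left; exists ('X_v * h); rewrite ?mulrA //; apply/(edge_gens_setU1 _ sym irr vW).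
  by left; exists h.
by right; exists v; rewrite setU11 vWK.
Qed.

Lemma star_gens_setU1 W v g : v \notin W ->
  star_gens (v |: W) g <-> link 'X_v (star_gens W) (eq (mono K W)) g.
Proof.
move=> vW; split.
  move=> [i /setU1P[->|iW] ->]; first by right; rewrite setU1K.
  left; exists (mono K (W :\ i)); first by exists i.
  rewrite -mono_setU1; last by rewrite inE negb_and vW orbT.
  congr mono; apply/setP => k; rewrite !inE; have [->|] //= := eqVneq k v.
  by rewrite andbT; apply: contraNneq vW => ->.
move=> [[h [i iW ->] ->]|<-]; last by exists v; rewrite ?setU11 // setU1K.
exists i; first by rewrite !inE iW orbT.
rewrite -mono_setU1; last by rewrite inE negb_and vW orbT.
congr mono; apply/setP => k; rewrite !inE; have [->|] //= := eqVneq k v.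
by rewrite andbT; apply/esym; apply: contraNneq vW => ->.
Qed.

Lemma mono_star W w : w \in W -> ideal_of (star_gens W) (mono K W).
Proof.
move=> wW; rewrite (mono_setD1 K wW); apply: ideal_likeM; first exact: ideal_of_ideal.
by apply: ideal_of_mem; exists w.
Qed.

Lemma mono_edge e W w x : ssrbool.symmetric e -> irreflexive e ->
  w \in W -> x \in W -> e w x ->
  ideal_of (edge_gens e W) (mono K (W :\ w)).
Proof.
move=> sym irr wW xW ewx; have xw : x != w by apply: contraTneq ewx => ->; rewrite irr.
rewrite (@mono_setD1 _ K (W :\ w) x) ?inE ?xw //.
apply: ideal_likeM; first exact: ideal_of_ideal.
by apply: ideal_of_mem; exists w, x; rewrite setDDl.
Qed.

Lemma wreg_mono_adjoin d W v : (d.+2 = n)%N -> v \notin W ->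
  wreg (adjoin (ideal_of (eq (mono K W))) 'X_v) (esyms n K d).
Proof.
move=> dn vW; apply: wreg_ext ((wreg_vars n K d).2 [set v] W _ _).
- by move=> h; apply: iff_sym; apply: adjoin_vars1.
- by rewrite cards1.
- by rewrite disjoints1.
Qed.

Lemma wreg_mono_adjoin2 d W u v : (d.+2 = n)%N -> u \notin W -> v \notin W ->
  wreg (adjoin (ideal_of (eq (mono K W))) ('X_u * 'X_v)) (esyms n K d).
Proof.
move=> dn uW vW; set M := mono K W.
apply: (@wreg_ext _ _ (ideal_of (link 'X_u (or_vars (eq M) [set v]) (eq M)))).
  move=> h; apply: iff_trans (iff_sym (adjoin_ideal_of _ _ _)).
  apply: ideal_of_ext => g.
    move=> [[g' [<-|[i /set1P -> ->]] ->]|<-].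
    - by apply: ideal_likeM; [apply: ideal_of_ideal | apply: ideal_of_mem; right].
    - by apply: ideal_of_mem; left.
    - by apply: ideal_of_mem; right.
  move=> [->|<-]; apply: ideal_of_mem; last by right.
  by left; exists 'X_v => //; right; exists v; rewrite ?set11.
apply: wreg_link.
- exact: single_gen_var.
- by move=> g <-; apply: ideal_of_mem; left.
- by apply: (wreg_vars n K d).2; rewrite ?cards1 ?disjoints1.
- exact: wreg_mono_adjoin.
Qed.

Lemma star_gens1 a : star_gens [set a] 1.
Proof. by exists a; rewrite ?set11 // setDv /mono big_set0. Qed.

(** Again by links: adding u to W turns the ideal J of all x_{W - w} into
    x_u J + (x_W). *)
Lemma wreg_star d C W : (#|C| + d.+2 = n)%N -> [disjoint C & W] -> W != set0 ->
  wreg (ideal_of (or_vars (star_gens W) C)) (esyms n K d).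
Proof.
move=> cC; elim: {W}#|W| {-2}W (erefl #|W|) => [|k IH] W cW dCW W0.
  by move: W0; rewrite (cards0_eq cW) eqxx.
have [u uW] := set0Pn _ W0.
have cW' : #|W :\ u| = k by apply/eqP; rewrite -eqSS -cW [X in _ == X](cardsD1 u) uW.
have dCW' : [disjoint C & W :\ u] by apply: disjointWr dCW; apply: subsetDl.
have uC : u \notin C by rewrite (disjointFl dCW).
have uW' : u \notin W :\ u by rewrite !inE eqxx.
have [W'0|W'n0] := eqVneq (W :\ u) set0.
  apply: wreg_unit; first exact: ideal_of_ideal.
  apply: ideal_of_mem; left.
  by rewrite -(setD1K uW) W'0 setU0; apply: star_gens1.
have [w wW'] := set0Pn _ W'n0.
set W' := W :\ u in cW' dCW' uW' W'n0 wW'.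
apply: (@wreg_ext _ _ (ideal_of (link 'X_u (or_vars (star_gens W') C)
                                      (or_vars (eq (mono K W')) C)))).
  have sE g := star_gens_setU1 g uW'; rewrite (setD1K uW) in sE.
  move=> h; apply: ideal_of_ext => g.
    move=> [[g' [Sg|Vg] ->]|[<-|Vg]].
    - by apply: ideal_of_mem; left; apply/sE; left; exists g'.
    - apply: ideal_likeM; first exact: ideal_of_ideal.
      by apply: ideal_of_mem; right.
    - by apply: ideal_of_mem; left; apply/sE; right.
    - by apply: ideal_of_mem; right.
  move=> [/sE [[g' Sg ->]|<-]|Vg]; apply: ideal_of_mem.
  - by left; exists g' => //; left.
  - by right; left.
  - by right; right.
apply: wreg_link.
- apply: regular_var => g [<-|[i iC ->]].
    by apply: kill_mono; rewrite disjoints1.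
  by rewrite killX inE; case: eqP => // iu; rewrite -iu iC in uC.
- move=> g [<-|Vg]; last by apply: ideal_of_mem; right.
  by apply: ideal_of_sub (mono_star wW') => g' Sg; apply: ideal_of_mem; left.
- exact: IH.
- apply: wreg_ext ((wreg_vars n K d).2 (u |: C) W' _ _).
  + by move=> h; apply: iff_sym; apply: adjoin_or_vars.
  + by rewrite cardsU1 uC add1n addSnnS.
  + by rewrite -setI_eq0 setIUl setU_eq0 !setI_eq0 disjoints1 uW'.
Qed.

Lemma edge_gens_complete e W u g : ssrbool.symmetric e -> irreflexive e ->
  is_complete e -> u \notin W ->
  edge_gens e (u |: W) g <-> link 'X_u (edge_gens e W) (star_gens W) g.
Proof.
move=> sym irr full uW; apply: iff_trans (edge_gens_setU1 _ sym irr uW) _.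
have eu w : w \in W -> e u w by move=> wW; apply: full; apply: contraTneq wW => <-.
split=> -[H|]; try by left.
  by move=> [w [wW _ ->]]; right; exists w.
by move=> [w wW ->]; right; exists w; split=> //; apply: eu.
Qed.

Lemma star_sub_complete e W f : ssrbool.symmetric e -> irreflexive e ->
  is_complete e -> (1 < #|W|)%N -> star_gens W f -> ideal_of (edge_gens e W) f.
Proof.
move=> sym irr full W1 [w wW ->].
have [x xW] : exists x, x \in W :\ w.
  by apply/card_gt0P; move: W1; rewrite (cardsD1 w) wW.
move: xW; rewrite in_setD1 => /andP[xw xW].
by apply: (mono_edge sym irr wW xW); apply: full; rewrite eq_sym.
Qed.

End LinkSteps.

(** * Resolutions by iterated links *)

Section Families.
Variables (n : nat) (K : fieldType).
Local Notation S := {mpoly K[n]}.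
Implicit Types (Q I : S -> Prop) (f g q : S) (W C : {set 'I_n}) (e : rel 'I_n).

Lemma mono_shom W : shom #|W| 0 (mono K W).
Proof. by move=> m; rewrite monoE msuppX inE => /eqP ->; rewrite mdeg_mesym1 addn0. Qed.

Lemma var_shom (i : 'I_n) : shom 1 0 ('X_i : S).
Proof. by move=> m; rewrite msuppX inE => /eqP ->; rewrite mdeg1. Qed.

Definition short2 I s r1 r2 (d2 : 'I_r2 -> nat) (G : 'M[S]_(r1, 1)) (D1 : 'M[S]_(r2, r1)) :=
  short_res I s d2 no_degree G D1 (0 : 'M_(0, r2)).

(** The case of a principal B = (m): a single new syzygy appears, of degree
    deg m + deg q. *)
Lemma short2_cone QA m q delta sA r1 r2 (d2 : 'I_r2 -> nat)
    (G : 'M_(r1, 1)) (D1 : 'M_(r2, r1)) :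
  short2 (ideal_of QA) sA d2 G D1 -> m != 0 -> shom (sA + delta) 0 m ->
  ideal_of QA m -> q != 0 -> shom delta 0 q -> (0 < delta)%N ->
  regular_mod (ideal_of (eq m)) q ->
  exists r1' r2' (d2' : 'I_r2' -> nat) (G' : 'M_(r1', 1)) (D1' : 'M_(r2', r1')),
  [/\ short2 (ideal_of (link q QA (eq m))) (sA + delta) d2' G' D1', r2' = r2.+1 &
      forall k, (exists i, d2' i = k) <->
        (exists i, d2 i + delta = k)%N \/ k = (sA + delta + delta)%N].
Proof.
move=> resA m0 hm Am q0 hq d0 rq.
have resB : short_res (ideal_of (eq m)) (sA + delta) no_degree no_degree (m%:M : 'M_1)
    (0 : 'M_(0, 1)) (0 : 'M_(0, 0)).
  by apply: short_res_principal => // f; split.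
have BA f : m = f -> ideal_of QA f by move=> <-.
have [|G' [D1' [D2' res]]] := short_res_cone resA resB q0 hq d0 rq BA; first by case.
exists (r1 + 1)%N, (r2 + (0 + 1))%N, (cone_deg2 delta sA d2 no_degree), G', D1'.
split; first exact: short_res_no_third res.
  by rewrite add0n addn1.
move=> k; split.
  move=> [i <-]; case: (split_ordP i) => j -> {i}.
    by left; exists j; rewrite /cone_deg2 cat_degreel.
  case: (split_ordP j) => l -> {j}; [by case: l | right].
  by rewrite /cone_deg2 !cat_degreer.
case=> [[i <-]|->].
  by exists (lshift _ i); rewrite /cone_deg2 cat_degreel.
by exists (rshift r2 (rshift 0 ord0)); rewrite /cone_deg2 !cat_degreer.
Qed.

Lemma short_res_iff Q Q' s r1 r2 r3 (d2 : 'I_r2 -> nat) (d3 : 'I_r3 -> nat)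
    (G : 'M_(r1, 1)) (D1 : 'M_(r2, r1)) (D2 : 'M_(r3, r2)) : (forall g, Q g <-> Q' g) ->
  short_res (ideal_of Q) s d2 d3 G D1 D2 -> short_res (ideal_of Q') s d2 d3 G D1 D2.
Proof. by move=> eqQ; apply: short_res_ext => f; apply: ideal_of_iff. Qed.

Lemma star_resolution W : W != set0 ->
  exists r1 r2 (d2 : 'I_r2 -> nat) (G : 'M_(r1, 1)) (D1 : 'M_(r2, r1)),
  [/\ short2 (ideal_of (@star_gens n K W)) #|W|.-1 d2 G D1, r2 = #|W|.-1 &
      forall i, d2 i = #|W|].
Proof.
elim: {W}#|W| {-2}W (erefl #|W|) => [|k IH] W cW W0.
  by move: W0; rewrite (cards0_eq cW) eqxx.
have [u uW] := set0Pn _ W0.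
have cW' : #|W :\ u| = k by apply/eqP; rewrite -eqSS -cW [X in _ == X](cardsD1 u) uW.
have uW' : u \notin W :\ u by rewrite !inE eqxx.
have [W'0|W'n0] := eqVneq (W :\ u) set0.
  have k0 : k = 0%N by rewrite -cW' W'0 cards0.
  rewrite cW k0; exists 1%N, 0%N, no_degree, 1%:M, 0; split; [| |by case].
    apply: (@short_res_principal _ _ _ 1); [exact: oner_neq0 | |].
      by move=> m; rewrite msupp1 inE => /eqP ->; rewrite mdeg0.
    move=> f; rewrite -(setD1K uW) W'0 setU0.
    have st1 i : i \in [set u] -> mono K ([set u] :\ i) = 1.
      by move=> /set1P ->; rewrite setDv /mono big_set0.
    by split=> [[i iu ->]|->]; [rewrite st1 | exists u; rewrite ?st1 ?set11].
  by [].
have [r1 [r2 [d2 [G [D1 [res er2 ed2]]]]]] := IH _ cW' W'n0.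
have [w wW'] := set0Pn _ W'n0.
have kE : k.-1.+1 = k by rewrite prednK // -cW' (cardD1 w) wW'.
rewrite cW' in res er2 ed2.
have [|||||||r1' [r2' [d2' [G' [D1' [res' er2' ed2']]]]]] :=
   @short2_cone _ (mono K (W :\ u)) 'X_u 1 _ _ _ _ _ _ res.
- exact: mono_neq0.
- by rewrite addn1 kE -{1}cW'; apply: mono_shom.
- exact: mono_star wW'.
- exact: mpolyX_neq0.
- exact: var_shom.
- by [].
- exact: single_gen_var.
exists r1', r2', d2', G', D1'; split.
- rewrite addn1 kE in res'; rewrite cW; apply: short_res_iff res' => g.
  by apply: iff_sym; have := star_gens_setU1 g uW'; rewrite (setD1K uW).
- by rewrite er2' er2 cW kE.
- move=> i; have /ed2' [[j <-]|->] : exists j, d2' j = d2' i by exists i.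
    by rewrite ed2 addn1 cW.
  by rewrite !addn1 kE cW.
Qed.

(** Adding a vertex u is a link with q = x_u and the star ideal on the old
    vertices; the syzygies of the star ideal become second syzygies. *)
Lemma complete_resolution e W : ssrbool.symmetric e -> irreflexive e ->
  is_complete e -> (1 < #|W|)%N ->
  exists r1 r2 r3 (d2 : 'I_r2 -> nat) (d3 : 'I_r3 -> nat)
    (G : 'M_(r1, 1)) (D1 : 'M_(r2, r1)) (D2 : 'M_(r3, r2)),
  [/\ short_res (ideal_of (@edge_gens n K e W)) (#|W| - 2) d2 d3 G D1 D2,
      forall i, d2 i = #|W|.-1, forall i, d3 i = #|W| & (2 < #|W|)%N -> (0 < r3)%N].
Proof.
move=> sym irr full.
elim: {W}#|W| {-2}W (erefl #|W|) => [|k IH] W cW W1; first by move: W1; rewrite cW.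
have [u uW] : exists u, u \in W by apply/card_gt0P; rewrite cW.
have cW' : #|W :\ u| = k by apply/eqP; rewrite -eqSS -cW [X in _ == X](cardsD1 u) uW.
have uW' : u \notin W :\ u by rewrite !inE eqxx.
set W' := W :\ u in cW' uW' *.
have gE g : @edge_gens n K e W g <-> link 'X_u (edge_gens e W') (star_gens W') g.
  by rewrite -{1}(setD1K uW); apply: edge_gens_complete.
have [k1|k1] := leqP k 1.
  have {k1 W1} k1 : k = 1%N by apply/eqP; rewrite eqn_leq k1 -ltnS -cW.
  have /cards1P [v eW'] : #|W'| == 1%N by rewrite cW' k1.
  rewrite cW k1; exists 1, 0, 0, no_degree, no_degree, 1%:M, 0, 0.
  split=> //; [|by case|by case].
  apply: short_res_principal; [exact: oner_neq0 | |].
    by move=> m; rewrite msupp1 inE => /eqP ->; rewrite mdeg0.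
  have vu : v != u by apply: contraNneq uW' => <-; rewrite eW' set11.
  move=> f; split.
    move=> /gE [[_ [i [j [+ + + _]]] _]|[i + ->]].
      by rewrite eW' => /set1P -> /set1P ->; rewrite irr.
    by rewrite eW' => /set1P ->; rewrite setDv /mono big_set0.
  move=> ->; apply/gE; right; exists v; rewrite eW' ?set11 //.
  by rewrite setDv /mono big_set0.
have W1' : (1 < #|W'|)%N by rewrite cW'.
have [r1 [r2 [r3 [d2 [d3 [G [D1 [D2 [resA ed2 ed3 _]]]]]]]]] := IH _ cW' W1'.
have W'0 : W' != set0 by rewrite -card_gt0 cW' ltnW.
have [r1B [r2B [d2B [GB [D1B [resB er2B ed2B]]]]]] := star_resolution W'0.
have sE : (#|W'|.-1 = #|W'| - 2 + 1)%N by rewrite cW'; lia.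
rewrite sE in resB.
have [|||G' [D1' [D2' res]]] := short_res_cone resA resB (mpolyX_neq0 K u) (@var_shom u) isT.
- exact: star_gens_var.
- by move=> f; apply: star_sub_complete => //; rewrite cW'.
- by move=> a b; rewrite ed2 ed2B cW'; lia.
exists (r1 + r1B)%N, (r2 + (r2B + r1B))%N, (r3 + r2B)%N, (cone_deg2 1 (#|W'| - 2) d2 d2B),
  (cone_deg3 1 d3 d2B), G', D1', D2'; split.
- have -> : (#|W| - 2 = #|W'| - 2 + 1)%N by rewrite cW cW'; lia.
  by apply: short_res_iff res => g; apply: iff_sym.
- move=> i; rewrite cW; case: (split_ordP i) => j -> {i}.
    by rewrite /cone_deg2 cat_degreel ed2 cW'; lia.
  case: (split_ordP j) => l ->; rewrite /cone_deg2 cat_degreer.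
    by rewrite cat_degreel ed2B cW'.
  by rewrite cat_degreer cW'; lia.
- move=> i; rewrite cW; case: (split_ordP i) => j ->.
    by rewrite /cone_deg3 cat_degreel ed3 cW' addn1.
  by rewrite /cone_deg3 cat_degreer ed2B cW' addn1.
- by move=> _; rewrite addn_gt0 er2B cW'; apply/orP; right; lia.
Qed.

Lemma complete_wreg e W d : ssrbool.symmetric e -> irreflexive e ->
  is_complete e -> (d.+3 = n)%N -> (1 < #|W|)%N ->
  wreg (ideal_of (edge_gens e W)) (esyms n K d).
Proof.
move=> sym irr full dn.
elim: {W}#|W| {-2}W (erefl #|W|) => [|k IH] W cW W1; first by move: W1; rewrite cW.
have [u uW] : exists u, u \in W by apply/card_gt0P; rewrite cW.
have cW' : #|W :\ u| = k by apply/eqP; rewrite -eqSS -cW [X in _ == X](cardsD1 u) uW.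
have uW' : u \notin W :\ u by rewrite !inE eqxx.
set W' := W :\ u in cW' uW' *.
have gE g : @edge_gens n K e W g <-> link 'X_u (edge_gens e W') (star_gens W') g.
  by rewrite -{1}(setD1K uW); apply: edge_gens_complete.
have [k1|k1] := leqP k 1.
  have {k1 W1} k1 : k = 1%N by apply/eqP; rewrite eqn_leq k1 -ltnS -cW.
  have /cards1P [v eW'] : #|W'| == 1%N by rewrite cW' k1.
  apply: wreg_unit; first exact: ideal_of_ideal.
  apply/ideal_of_mem/gE; right; rewrite eW'; exact: star_gens1.
have W'0 : W' != set0 by rewrite -card_gt0 cW' ltnW.
apply: (@wreg_iff _ _ (link 'X_u (edge_gens e W') (star_gens W'))).
  by move=> g; apply: iff_sym.
apply: wreg_link.
- exact: star_gens_var.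
- by move=> f; apply: star_sub_complete => //; rewrite cW'.
- by apply: IH; rewrite // cW'.
- apply: wreg_ext (@wreg_star n K d [set u] W' _ _ W'0).
  + by move=> h; apply: iff_sym; apply: adjoin_vars1.
  + by rewrite cards1.
  + by rewrite disjoints1.
Qed.

End Families.

(** * Forests *)

Section ForestInduction.
Variables (n : nat) (e : rel 'I_n).
Hypothesis e_sym : ssrbool.symmetric e.
Hypothesis acyclic : forall c, ucycle e c -> ~ (2 < size c)%N.
Hypothesis no_isolated : forall i, exists j, e i j.
Implicit Types (W : {set 'I_n}).

Definition inside W : rel 'I_n := [rel x y | [&& x \in W, y \in W & e x y]].

Lemma closed_connect W a b : (forall x y, x \in W -> e x y -> y \in W) ->
  a \in W -> connect e a b -> b \in W.
Proof.
move=> clW aW /connectP [p pe ->]; elim: p a aW pe => //= c p IH a aW /andP[eac pe].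
by apply: IH pe; apply: clW eac.
Qed.

Lemma inside_sub W W' a b : W \subset W' -> connect (inside W) a b -> connect (inside W') a b.
Proof.
move=> /subsetP sub; apply: connect_sub => x y /and3P[xW yW exy]; apply: connect1.
by apply/and3P; split=> //; apply: sub.
Qed.

(** A second neighbour of v in W would close a cycle through v. *)
Lemma unique_neighbor W v w x :
  (forall a b, a \in W -> b \in W -> connect e a b -> connect (inside W) a b) ->
  v \notin W -> w \in W -> x \in W -> e v w -> e v x -> x = w.
Proof.
move=> conW vW wW xW evw evx; apply/eqP; apply: contraT => xw.
have : connect (inside W) w x.
  by apply: conW => //; apply: connect_trans (connect1 evx); apply: connect1; rewrite e_sym.
move=> /connectP [p0 p0e ex]; case: (shortenP p0e) ex => p pe U _ ex {p0 p0e}.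
case: (acyclic (c := [:: v, w & p])); last first.
  by case: p ex pe U => // ex; rewrite ex eqxx in xw.
apply/andP; split.
  rewrite (cycle_path v) /= -ex e_sym evx evw /=.
  by apply: sub_path pe => a b /and3P[].
rewrite cons_uniq U andbT; apply/negP => vp.
have : all (fun y => y \in W) (w :: p).
  rewrite /= wW /=; elim: p w pe {wW evw ex U vp xw} => //= c p IH w /andP[/and3P[_ -> _] pe] /=.
  exact: IH pe.
by move=> /allP/(_ _ vp); apply/negP.
Qed.

(** Grow W inside one component until no edge leaves it, then start a new
    component with an edge.  The invariant that W induces connected pieces of
    the components makes the neighbour of a new vertex unique. *)
Lemma forest_ind (P : {set 'I_n} -> Prop) : (0 < n)%N ->
  (forall a b, e a b -> P [set a; b]) ->
  (forall W v w x, P W -> v \notin W -> w \in W -> e v w -> x \in W -> e w x ->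
     (forall y, y \in W -> e v y -> y = w) -> P (v |: W)) ->
  (forall W u v, P W -> W != set0 -> u \notin W -> v \notin W -> e u v ->
     (forall x y, x \in W -> e x y -> y \in W) -> P (u |: (v |: W))) ->
  P setT.
Proof.
move=> n0 Pbase Pleaf Pedge.
pose good W := [/\ W != set0, forall w, w \in W -> exists2 x, x \in W & e w x,
  forall a b, a \in W -> b \in W -> connect e a b -> connect (inside W) a b & P W].
suff H k W : (#|~: W| <= k)%N -> good W -> P setT.
  have [j eij] := no_isolated (Ordinal n0); move: eij; set i := Ordinal n0 => eij.
  apply: (H _ [set i; j] (leqnn _)); split.
  - by apply/set0Pn; exists i; rewrite !inE eqxx.
  - move=> w; rewrite !inE => /orP[]/eqP ->; first by exists j; rewrite ?inE ?eqxx ?orbT.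
    by exists i; rewrite ?inE ?eqxx // e_sym.
  - have c1 : connect (inside [set i; j]) i j.
      by apply: connect1; rewrite /inside /= !inE !eqxx orbT.
    have c2 : connect (inside [set i; j]) j i.
      by apply: connect1; rewrite /inside /= !inE !eqxx orbT e_sym.
    by move=> a b; rewrite !inE => /orP[]/eqP -> /orP[]/eqP -> _; rewrite ?connect0.
  - exact: Pbase.
elim: k W => [|k IH] W cW [W0 isoW conW PW].
  by move: cW; rewrite leqn0 => /eqP/cards0_eq e0; rewrite -[setT]setCK setCT -e0 setCK.
have [/existsP [w /existsP [v /and3P[wW vW ewv]]]|noleave] :=
    boolP [exists w, exists v, [&& w \in W, v \notin W & e w v]].
  have evw : e v w by rewrite e_sym.
  have uniqv y : y \in W -> e v y -> y = w.
    by move=> yW evy; apply: (unique_neighbor conW vW wW yW evw evy).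
  have [x xW ewx] := isoW _ wW.
  apply: (IH (v |: W)).
    move: cW; rewrite (cardsD1 v) inE vW /= add1n ltnS setCU.
    by have -> : ~: W :\ v = ~: [set v] :&: ~: W by rewrite setDE setIC.
  split; first by apply/set0Pn; exists v; rewrite setU11.
  - move=> y /setU1P[->|yW]; first by exists w; rewrite ?inE ?wW ?orbT.
    by have [z zW eyz] := isoW _ yW; exists z; rewrite ?inE ?zW ?orbT.
  - pose rep a := if a == v then w else a.
    have sub : W \subset v |: W by apply: subsetUr.
    have vw' : inside (v |: W) v w by rewrite /inside /= setU11 inE wW orbT.
    have wv' : inside (v |: W) w v by rewrite /inside /= setU11 inE wW orbT ewv.
    have repW a : a \in v |: W -> rep a \in W.
      by rewrite /rep => /setU1P[->|aW]; [rewrite eqxx | case: eqP].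
    have rep1 a : connect (inside (v |: W)) a (rep a).
      by rewrite /rep; case: eqP => [->|_]; [apply: connect1 | apply: connect0].
    have rep2 a : connect (inside (v |: W)) (rep a) a.
      by rewrite /rep; case: eqP => [->|_]; [apply: connect1 | apply: connect0].
    have connect_inside : forall a b, connect (inside (v |: W)) a b -> connect e a b.
      by move=> a b; apply: connect_sub => c d /and3P[_ _ ecd]; apply: connect1.
    move=> a b aW bW cab.
    apply: connect_trans (rep1 a) _; apply: connect_trans _ (rep2 b).
    apply: (inside_sub sub); apply: conW; try exact: repW.
    apply: connect_trans (connect_inside _ _ (rep2 a)) _; apply: connect_trans cab _.
    exact: connect_inside (rep1 b).
  - exact: Pleaf PW vW wW evw xW ewx uniqv.
have clW x y : x \in W -> e x y -> y \in W.
  move=> xW exy; apply: contraT => yW; case/negP: noleave.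
  by apply/existsP; exists x; apply/existsP; exists y; rewrite xW yW.
have [WT|] := eqVneq (~: W) set0.
  by rewrite -[setT]setCK setCT -WT setCK.
move=> /set0Pn [v]; rewrite inE => vW.
have [u evu] := no_isolated v.
have uW : u \notin W by apply: contra vW => uW; apply: clW uW _; rewrite e_sym.
apply: (IH (u |: (v |: W))).
  have : (#|~: (u |: (v |: W))| < #|~: W|)%N; last by move=> lt; rewrite -ltnS (leq_trans lt).
  apply: proper_card; apply/properP; split; last by exists v; rewrite !inE ?vW ?eqxx ?orbT.
  by rewrite setCS; apply/subsetP => y yW; rewrite !inE yW !orbT.
split; first by apply/set0Pn; exists u; rewrite setU11.
- move=> w /setU1P[->|/setU1P[->|wW]].
  + by exists v; rewrite ?inE ?eqxx ?orbT // e_sym.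
  + by exists u; rewrite ?inE ?eqxx.
  + by have [x xW ewx] := isoW _ wW; exists x; rewrite ?inE ?xW ?orbT.
- have csym : connect_sym e by apply: sym_connect_sym.
  have sub : W \subset u |: (v |: W) by apply/subsetP => y yW; rewrite !inE yW !orbT.
  have uv' : inside (u |: (v |: W)) u v by rewrite /inside /= !inE !eqxx !orbT e_sym.
  have vu' : inside (u |: (v |: W)) v u by rewrite /inside /= !inE !eqxx !orbT evu.
  have out a b : a \in W -> b \notin W -> connect e a b = false.
    by move=> aW; apply: contraNF; apply: closed_connect.
  have cuv := connect1 uv'; have cvu := connect1 vu'.
  move=> a b /setU1P[->|/setU1P[->|aW]] /setU1P[->|/setU1P[->|bW]] // cab;
    try by [rewrite connect0 | rewrite csym out in cab | rewrite out in cab].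
  by apply: (inside_sub sub); apply: conW.
- by apply: Pedge => //; rewrite e_sym.
Qed.

End ForestInduction.

Section Forests.
Variables (n : nat) (K : fieldType) (e : rel 'I_n).
Local Notation S := {mpoly K[n]}.
Hypotheses (e_sym : ssrbool.symmetric e) (e_irr : irreflexive e).
Implicit Types (W : {set 'I_n}).

Definition fork W :=
  exists w x y, [/\ w \in W, x \in W, y \in W, x != y & e w x && e w y].

Definition disconnected W := exists x y, [/\ x \in W, y \in W & ~~ connect e x y].

(** What is transported along the construction of a forest: the degrees of the
    syzygies record whether two edges meet and whether W is disconnected. *)
Definition forest_data d W :=
  [/\ (1 < #|W|)%N, wreg (ideal_of (@edge_gens n K e W)) (esyms n K d) &
    exists r1 r2 (d2 : 'I_r2 -> nat) (G : 'M_(r1, 1)) (D1 : 'M_(r2, r1)),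
      [/\ short2 (ideal_of (@edge_gens n K e W)) (#|W| - 2) d2 G D1,
          (2 < #|W|)%N -> (0 < r2)%N,
          forall i, d2 i = #|W|.-1 \/ d2 i = #|W|,
          (exists i, d2 i = #|W|.-1) <-> fork W &
          (exists i, d2 i = #|W|) <-> disconnected W]].

Lemma edge_neq a b : e a b -> a != b.
Proof. by apply: contraTneq => ->; rewrite e_irr. Qed.

Lemma forest_data_edge d a b : e a b -> forest_data d [set a; b].
Proof.
move=> eab; have ab := edge_neq eab.
have c2 : #|[set a; b]| = 2%N by rewrite cards2 ab.
have g1 : @edge_gens n K e [set a; b] 1.
  by exists a, b; rewrite !inE !eqxx orbT setDv /mono big_set0.
have gE f : @edge_gens n K e [set a; b] f <-> f = 1.
  split=> [[i [j [iab jab eij ->]]]|->] //.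
  have -> : [set i; j] = [set a; b]; last by rewrite setDv /mono big_set0.
  have ij := edge_neq eij; apply/eqP; rewrite eqEcard c2 cards2 ij andbT.
  by apply/subsetP => k /set2P[]->.
split; first by rewrite c2.
  by apply: wreg_unit; [apply: ideal_of_ideal | apply: ideal_of_mem].
rewrite c2; exists 1%N, 0%N, no_degree, 1%:M, 0; split=> //; try by case.
- apply: short_res_principal => //; first exact: oner_neq0.
  by move=> m; rewrite msupp1 inE => /eqP ->; rewrite mdeg0.
- split=> [[[]]|[w [x [y [wab xab yab xy /andP[ewx ewy]]]]]] //.
  case/set2P: xab xy ewx => ->; case/set2P: yab ewy => ->; case/set2P: wab => ->;
    by rewrite ?eqxx ?e_irr.
- split=> [[[]]|[x [y [xab yab nc]]]] //; case/negP: nc.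
  have cab : connect e a b by apply: connect1.
  have cba : connect e b a by apply: connect1; rewrite e_sym.
  by move: xab yab => /set2P[]-> /set2P[]->; rewrite ?connect0.
Qed.

(** The new syzygy has degree |W|, one less than the new number of vertices; the
    edges vw and wx meet, and connectedness is unaffected. *)
Lemma forest_data_leaf d W v w x : (d.+2 = n)%N -> forest_data d W -> v \notin W -> w \in W ->
  e v w -> x \in W -> e w x -> (forall y, y \in W -> e v y -> y = w) -> forest_data d (v |: W).
Proof.
move=> dn [W1 regW [r1 [r2 [d2 [G [D1 [res _ d2E forkE discE]]]]]]] vW wW evw xW ewx uniqv.
have vW' : v \notin W :\ w by rewrite inE negb_and vW orbT.
have gE g : @edge_gens n K e (v |: W) g <->
    link 'X_v (edge_gens e W) (eq (mono K (W :\ w))) g.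
  apply: iff_trans (edge_gens_setU1 _ e_sym e_irr vW) _.
  split=> -[H|]; try by left.
    by move=> [y [yW evy ->]]; right; rewrite (uniqv y).
  by move=> <-; right; exists w.
have cW : #|v |: W| = #|W|.+1 by rewrite cardsU1 vW add1n.
have cWw : #|W :\ w| = #|W|.-1 by rewrite (cardsD1 w W) wW.
have mW : ideal_of (edge_gens e W) (mono K (W :\ w)) by apply: (mono_edge K e_sym e_irr wW xW).
have sE : (#|W|.-1 = #|W| - 2 + 1)%N by lia.
split; first by rewrite cW ltnS ltnW.
  apply: (@wreg_iff _ _ (link 'X_v (edge_gens e W) (eq (mono K (W :\ w))))).
    by move=> g; apply: iff_sym.
  apply: wreg_link => //; first exact: single_gen_var.
    by move=> g <-.
  exact: wreg_mono_adjoin.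
have [|||||||r1' [r2' [d2' [G' [D1' [res' er2' ed2']]]]]] :=
   @short2_cone n K _ (mono K (W :\ w)) 'X_v 1 _ _ _ _ _ _ res.
- exact: mono_neq0.
- by rewrite -sE -cWw; apply: mono_shom.
- exact: mW.
- exact: mpolyX_neq0.
- exact: var_shom.
- by [].
- exact: single_gen_var.
have lastE : (#|W| - 2 + 1 + 1 = #|W|)%N by lia.
rewrite lastE in ed2'.
exists r1', r2', d2', G', D1'; rewrite cW; split.
- have -> : (#|W|.+1 - 2 = #|W| - 2 + 1)%N by lia.
  by apply: short_res_iff res' => g; apply: iff_sym.
- by rewrite er2'.
- move=> i; have /ed2' [[j <-]|->] : exists j, d2' j = d2' i by exists i.
    by case: (d2E j) => ->; rewrite addn1 /=; [left | right]; rewrite ?prednK // ltnW.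
  by left.
- split=> _; last by apply/ed2'; right.
  exists w, x, v; rewrite !inE wW xW eqxx !orbT ewx e_sym evw; split=> //.
  by apply: contraNneq vW => <-.
split.
  move=> /ed2' [[j ej]|/eqP]; last by rewrite eqn_leq ltnn.
  have /discE [y [z [yW zW nc]]] : exists i, d2 i = #|W|.
    by exists j; apply/eqP; rewrite -eqSS -addn1 ej.
  by exists y, z; rewrite !inE yW zW !orbT.
have csym : connect_sym e by apply: sym_connect_sym.
have cvw : connect e v w := connect1 evw.
move=> [y [z [yW zW nc]]]; apply/ed2'; left.
have /discE [j ej] : disconnected W; last by exists j; rewrite ej addn1.
case/setU1P: yW nc => [->|yW] nc; case/setU1P: zW nc => [->|zW] nc.
- by rewrite connect0 in nc.
- exists w, z; split=> //; apply: contra nc; exact: connect_trans.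
- exists y, w; split=> //; apply: contra nc => cyw; apply: connect_trans cyw _.
  by rewrite csym.
- by exists y, z.
Qed.

(** The new syzygy has degree |W| + 2, the new number of vertices; u and v are not
    connected to W, and no two edges meet that did not meet before. *)
Lemma forest_data_new_edge d W u v :
  (forall i, exists j, e i j) -> (d.+2 = n)%N -> forest_data d W -> W != set0 ->
  u \notin W -> v \notin W -> e u v -> (forall x y, x \in W -> e x y -> y \in W) ->
  forest_data d (u |: (v |: W)).
Proof.
move=> no_isolated dn [W1 regW [r1 [r2 [d2 [G [D1 [res _ d2E forkE discE]]]]]]] W0 uW vW euv clW.
have uv := edge_neq euv.
have gE g : @edge_gens n K e (u |: (v |: W)) g <->
    link ('X_u * 'X_v) (edge_gens e W) (eq (mono K W)) g by apply: edge_gens_setU2.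
have cW : #|u |: (v |: W)| = #|W|.+2.
  by rewrite cardsU1 !inE negb_or uv uW cardsU1 vW !add1n.
have [w wW] := set0Pn _ W0.
have mW : ideal_of (edge_gens e W) (mono K W).
  have [x ewx] := no_isolated w; have xW := clW _ _ wW ewx.
  rewrite (mono_setD1 K wW); apply: ideal_likeM; first exact: ideal_of_ideal.
  exact: (mono_edge K e_sym e_irr wW xW).
have q_reg : regular_mod (ideal_of (eq (mono K W))) ('X_u * 'X_v).
  by move=> h; rewrite -mulrA => /(single_gen_var uW)/(single_gen_var vW).
split; first by rewrite cW.
  apply: (@wreg_iff _ _ (link ('X_u * 'X_v) (edge_gens e W) (eq (mono K W)))).
    by move=> g; apply: iff_sym.
  apply: wreg_link => //; first by move=> g <-.
  exact: wreg_mono_adjoin2.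
have sE : (#|W| = #|W| - 2 + 2)%N by lia.
have [|||||||r1' [r2' [d2' [G' [D1' [res' er2' ed2']]]]]] :=
   @short2_cone n K _ (mono K W) ('X_u * 'X_v) 2 _ _ _ _ _ _ res.
- exact: mono_neq0.
- by rewrite -sE; apply: mono_shom.
- exact: mW.
- by rewrite mulf_neq0 ?mpolyX_neq0.
- apply: (@shomM _ _ 2 1 0); last exact: var_shom.
  exact: (@shom_shift _ _ 1 0 1 _ (@var_shom _ _ u)).
- by [].
- exact: q_reg.
have lastE : (#|W| - 2 + 2 + 2 = #|W|.+2)%N by lia.
rewrite lastE in ed2'.
exists r1', r2', d2', G', D1'; rewrite cW; split.
- have -> : (#|W|.+2 - 2 = #|W| - 2 + 2)%N by lia.
  by apply: short_res_iff res' => g; apply: iff_sym.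
- by rewrite er2'.
- move=> i; have /ed2' [[j <-]|->] : exists j, d2' j = d2' i by exists i.
    by case: (d2E j) => ->; rewrite addn2 /=; [left; rewrite prednK // ltnW | right].
  by right.
- split.
    move=> /ed2' [[j ej]|/eqP]; last by rewrite eqn_leq /= ltnn andbF.
    have /forkE [y [z [t [yW zW tW zt ee]]]] : exists i, d2 i = #|W|.-1.
      by exists j; have := ltnW W1; move: ej; rewrite addn2 /=; lia.
    by exists y, z, t; rewrite !inE yW zW tW !orbT.
  move=> [y [z [t [yW zW tW zt /andP[eyz eyt]]]]]; apply/ed2'; left.
  have nbu a : e u a -> a \in u |: (v |: W) -> a = v.
    move=> eua /setU1P[eau|/setU1P[//|aW]]; first by rewrite eau e_irr in eua.
    by case/negP: uW; apply: (clW a) => //; rewrite e_sym.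
  have nbv a : e v a -> a \in u |: (v |: W) -> a = u.
    move=> eva /setU1P[//|/setU1P[eav|aW]]; first by rewrite eav e_irr in eva.
    by case/negP: vW; apply: (clW a) => //; rewrite e_sym.
  case/setU1P: yW eyz eyt => [->|/setU1P[->|yW]] eyz eyt.
  + by rewrite (nbu _ eyz zW) (nbu _ eyt tW) eqxx in zt.
  + by rewrite (nbv _ eyz zW) (nbv _ eyt tW) eqxx in zt.
  have /forkE [j ej] : fork W.
    by exists y, z, t; split; rewrite ?eyz ?eyt // ?(clW _ _ yW eyz) ?(clW _ _ yW eyt).
  by exists j; rewrite ej addn2; have := ltnW W1; lia.
split=> _; last by apply/ed2'; right.
exists w, u; rewrite !inE wW eqxx !orbT; split=> //.
by apply: contra uW; apply: closed_connect.
Qed.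

End Forests.


(** * Levelness *)

Section Levelness.
Variables (n : nat) (K : fieldType) (e : rel 'I_n).
Local Notation S := {mpoly K[n]}.
Hypotheses (e_sym : ssrbool.symmetric e) (e_irr : irreflexive e).
Hypothesis no_isolated : forall i, exists j, e i j.
Hypothesis n_ge4 : (4 <= n)%N.
Implicit Types (W C : {set 'I_n}) (f g : S).

Local Notation gens := (@edge_gens n K e setT).
Local Notation I := (ideal_of gens).

Lemma edge_gens_monomial g : gens g -> exists2 W : {set 'I_n}, #|W| = (n - 2)%N & g = mono K W.
Proof.
move=> [i [j [_ _ eij ->]]]; exists (setT :\: [set i; j]) => //.
by rewrite setTD cardsCs setCK card_ord cards2 (edge_neq e_irr eij).
Qed.

Lemma edge_ideal_const f : I f -> f@_0%MM = 0.
Proof.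
apply: (@ideal_of_min _ _ _ (fun f => f@_0%MM = 0)); first exact: const_ideal_like.
move=> g /edge_gens_monomial [W cW ->]; apply/eqP.
apply: contraLR n_ge4 => /(shom_const (@mono_shom n K W)).
by rewrite cW; lia.
Qed.

Lemma edge_ideal_order f : I f -> order_ge (n - 2) f.
Proof.
elim=> [|f' c g _ IH /edge_gens_monomial [W cW ->]] m; first by rewrite msupp0.
move=> /msuppD_le; rewrite mem_cat => /orP[/IH //|].
have oW : order_ge (n - 2) (mono K W).
  by move=> m' /(@mono_shom n K W); rewrite addn0 cW => ->.
by apply: (@order_geM _ _ 0 (n - 2) c).
Qed.

Lemma edge_ideal_graded k f : I f -> I (graded_part k 0 f).
Proof.
apply: ideal_of_graded_part => g /edge_gens_monomial [W _ ->]; exists #|W|; exact: mono_shom.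
Qed.

Lemma edge_ideal_edge i j : e i j -> I (mono K (~: [set i; j])).
Proof. by move=> eij; apply: ideal_of_mem; exists i, j; rewrite !inE setTD. Qed.

(** Divisibility: x_C is a multiple of the generator of the edge ij. *)
Lemma edge_ideal_mono C i j : e i j -> ~: C \subset [set i; j] -> I (mono K C).
Proof.
move=> eij sub; rewrite /mono (big_setID (~: [set i; j])) /= mulrC.
apply: ideal_likeM; first exact: ideal_of_ideal.
have -> : C :&: ~: [set i; j] = ~: [set i; j]; last exact: edge_ideal_edge.
by apply/setIidPr; rewrite -[C]setCK setCS.
Qed.

Lemma edge_ideal_mono_codim1 C : (n - 2 < #|C|)%N -> I (mono K C).
Proof.
move=> cC; have [i iC] : exists i, ~: C \subset [set i].
  have : (#|~: C| <= 1)%N by have := cardsC C; rewrite card_ord; lia.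
  rewrite leq_eqVlt ltnS leqn0 => /orP[/cards1P [i ->]|/eqP/cards0_eq ->].
    by exists i.
  have n0 : (0 < n)%N by apply: leq_trans n_ge4.
  by exists (Ordinal n0); apply: sub0set.
have [j eij] := no_isolated i; apply: (edge_ideal_mono eij); apply: subset_trans iC _.
by rewrite sub1set !inE eqxx.
Qed.

Lemma edge_ideal_mono_codim2 C : is_complete e -> (n - 3 < #|C|)%N -> I (mono K C).
Proof.
move=> full cC; have c2 : (#|~: C| <= 2)%N by have := cardsC C; rewrite card_ord; lia.
have [lt1|ge1] := ltnP (n - 2) #|C|; first exact: edge_ideal_mono_codim1.
have /cards2P [i [j [ij eC]]] : #|~: C| == 2 by have := cardsC C; rewrite card_ord; lia.
by apply: (edge_ideal_mono (full i j ij)); rewrite eC.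
Qed.

Lemma edge_ideal_kill C f :
  (forall i j, e i j -> ~~ (C \subset [set i; j])) -> I f -> kill C f = 0.
Proof.
move=> nC; apply: (@ideal_of_min _ _ _ (fun f => kill C f = 0)).
  split; first exact: rmorph0.
  - by move=> u v u0 v0; rewrite rmorphD /= u0 v0 addr0.
  - by move=> c u u0; rewrite rmorphM /= u0 mulr0.
move=> g [i [j [_ _ eij ->]]]; have /subsetPn [k kC nk] := nC i j eij.
by apply: (kill_mono0 K kC); rewrite inE nk inE.
Qed.

Lemma nonedge_cover i j : i != j -> ~~ e i j ->
  forall a b, e a b -> ~~ ([set i; j] \subset [set a; b]).
Proof.
move=> ij nij a b eab; apply: contra nij => /subsetP sub.
have := sub i; have := sub j; rewrite !inE !eqxx orbT.
move=> /(_ isT) /orP[]/eqP ej /(_ isT) /orP[]/eqP ei; move: ij; rewrite ei ej ?eqxx //.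
by rewrite e_sym.
Qed.

Lemma betti_neq0 (F : graded_maps n K) p j :
  betti F p j <> 0%N <-> exists a : 'I_(rk F p), deg a = j.
Proof.
rewrite /betti; split.
  by move=> /eqP; rewrite cards_eq0 => /set0Pn [a]; rewrite inE => /eqP; exists a.
by move=> [a ea]; apply/eqP; rewrite cards_eq0; apply/set0Pn; exists a; rewrite inE ea.
Qed.

Lemma complete_level : is_complete e -> is_level I.
Proof.
move=> full; have idI := ideal_of_ideal gens.
have cT : #|[set: 'I_n]| = n by rewrite cardsT card_ord.
have T1 : (1 < #|[set: 'I_n]|)%N by rewrite cT; lia.
split.
  pose o k (lt : (k < 4)%N) : 'I_n := Ordinal (leq_trans lt n_ge4).
  pose C := [set o 0%N isT; o 1%N isT; o 2%N isT].
  have cC : #|C| = 3%N by rewrite /C -setUA cardsU1 cards2 !inE.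
  apply: (@cohen_macaulay_vars _ _ _ C (n - 3)) => //.
  - exact: edge_ideal_const.
  - by rewrite cC; lia.
  - move=> f; apply: edge_ideal_kill => i j _; apply: contraTN isT => /subset_leq_card.
    by rewrite cC cards2; case: (_ != _).
  - by move=> U; apply: edge_ideal_mono_codim2.
  - apply: (complete_wreg K e_sym e_irr) => //; lia.
have [r1 [r2 [r3 [d2 [d3 [G [D1 [D2 [res _ d3E r3_gt0]]]]]]]]] :=
  complete_resolution K e_sym e_irr full T1.
have {}r3_gt0 : (0 < r3)%N by apply: r3_gt0; rewrite cT; lia.
rewrite cT in res d3E.
exists (resolution_maps (n - 2) d2 d3 G D1 D2); split.
  by apply: resolution_maps_minimal res => //; lia.
exists 3%N.
  split; first by move=> r0; rewrite /= in r0; rewrite r0 in r3_gt0.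
  by do 4!case=> //.
exists n; split; first by apply/betti_neq0; exists (Ordinal r3_gt0); rewrite /= d3E.
by move=> j /betti_neq0 [a] /= <-; rewrite d3E.
Qed.

Hypothesis acyclic : forall c, ucycle e c -> ~ (2 < size c)%N.

Lemma acyclic_forest_data : forest_data K e (n - 2) setT.
Proof.
have dn : ((n - 2).+2 = n)%N by lia.
apply: (forest_ind e_sym acyclic no_isolated) => //; first by lia.
- by move=> a b; apply: forest_data_edge.
- move=> W v w x FW vW wW evw xW ewx uniqv.
  by apply: (forest_data_leaf e_sym e_irr dn FW vW wW evw xW ewx).
- by move=> W u v FW W0 uW vW euv clW; apply: forest_data_new_edge.
Qed.

Lemma acyclic_cohen_macaulay : cohen_macaulay I.
Proof.
have idI := ideal_of_ideal gens.
pose o k (lt : (k < 4)%N) : 'I_n := Ordinal (leq_trans lt n_ge4).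
have [i [j [ij nij]]] : exists i j, i != j /\ ~~ e i j.
  have [e01|n01] := boolP (e (o 0%N isT) (o 1%N isT)); last by exists (o 0%N isT), (o 1%N isT).
  have [e12|n12] := boolP (e (o 1%N isT) (o 2%N isT)); last by exists (o 1%N isT), (o 2%N isT).
  exists (o 2%N isT), (o 0%N isT); split=> //; apply/negP => e20.
  by case: (@acyclic [:: o 0%N isT; o 1%N isT; o 2%N isT]) => //=; rewrite /ucycle /= e01 e12 e20.
have [_ wI _] := acyclic_forest_data.
apply: (@cohen_macaulay_vars _ _ _ [set i; j] (n - 2)) => //.
- exact: edge_ideal_const.
- by rewrite cards2 ij; lia.
- by move=> f; apply: edge_ideal_kill; apply: nonedge_cover.
- by move=> U; apply: edge_ideal_mono_codim1.
Qed.

Lemma tree_not_disconnected : is_tree e -> ~ disconnected e setT.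
Proof. by move=> [con _] [x [y [_ _]]]; rewrite con. Qed.

Lemma disjoint_edges_no_fork : is_disjoint_union_of_edges e -> ~ fork e setT.
Proof.
move=> dj [w [x [y [_ _ _ xy /andP[ewx ewy]]]]]; have [j _ con] := dj w.
have eqj z : e w z -> z = j.
  move=> ewz; have : z \in [:: w; j] by rewrite -con connect1.
  by rewrite !inE => /orP[]/eqP // zw; rewrite zw e_irr in ewz.
by rewrite (eqj x) // (eqj y) // eqxx in xy.
Qed.

Lemma forest_level : ~ disconnected e setT \/ ~ fork e setT -> is_level I.
Proof.
move=> H; split; first exact: acyclic_cohen_macaulay.
have idI := ideal_of_ideal gens.
have cT : #|[set: 'I_n]| = n by rewrite cardsT card_ord.
have [_ _ [r1 [r2 [d2 [G [D1 [res r2_gt0 d2E forkE discE]]]]]]] := acyclic_forest_data.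
rewrite cT in res r2_gt0 d2E forkE discE.
have {}r2_gt0 : (0 < r2)%N by apply: r2_gt0; lia.
exists (resolution_maps (n - 2) d2 no_degree G D1 0); split.
  by apply: resolution_maps_minimal res => //; lia.
exists 2%N.
  split; first by move=> r0; rewrite /= in r0; rewrite r0 in r2_gt0.
  by do 4!case=> //.
have [j jE] : exists j, forall i, d2 i = j.
  case: H => H; [exists n.-1|exists n] => i; case: (d2E i) => // di; case: H.
    by apply/discE; exists i.
  by apply/forkE; exists i.
exists j; split; first by apply/betti_neq0; exists (Ordinal r2_gt0); rewrite /= jE.
by move=> j' /betti_neq0 [a] /= <-; rewrite jE.
Qed.

(** Both degrees n - 1 and n occur in the explicit resolution, hence in F. *)
Lemma level_forest : is_level I -> ~ (fork e setT /\ disconnected e setT).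
Proof.
move=> [_ [F [resF [p [rp0 pmax] [j [_ uniqj]]]]]] [fk dc].
have idI := ideal_of_ideal gens.
have cT : #|[set: 'I_n]| = n by rewrite cardsT card_ord.
have [_ _ [r1 [r2 [d2 [G [D1 [res r2_gt0 d2E forkE discE]]]]]]] := acyclic_forest_data.
rewrite cT in res forkE discE.
set E := resolution_maps (n - 2) d2 no_degree G D1 0.
have resE : minimal_graded_free_resolution I E.
  by apply: resolution_maps_minimal res => //; lia.
have FE := resolution_degrees idI edge_ideal_graded resF resE.
have EF := resolution_degrees idI edge_ideal_graded resE resF.
have [i1 ei1] := forkE.2 fk; have [i2 ei2] := discE.2 dc.
have [b1 eb1] := EF 2%N i1; have [b2 eb2] := EF 2%N i2.
rewrite /= ei1 in eb1; rewrite /= ei2 in eb2.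
have p2 : p = 2%N.
  apply/eqP; rewrite eqn_leq; apply/andP; split.
    rewrite leqNgt; apply/negP => lt.
    have [a _] : exists a : 'I_(rk F p), True.
      by move/eqP: rp0; rewrite -lt0n => r0; exists (Ordinal r0).
    have [b _] := FE p a; case: p lt b {rp0 pmax uniqj a} => [|[|[|[|p]]]] // _; by case.
  rewrite leqNgt; apply/negP => /pmax r0; move: b1 {eb1}; rewrite r0; by case.
subst p.
have jn : j = n by apply: uniqj; apply/betti_neq0; exists b2.
have : j = n.-1 by apply: uniqj; apply/betti_neq0; exists b1.
by rewrite jn; lia.
Qed.

End Levelness.

(** A missing edge gives dimension at least n - 2, so the length of a maximal
    regular sequence exceeds what a Koszul class of degree three permits. *)
Lemma level_acyclic n (K : fieldType) (e : rel 'I_n) c :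
  (4 <= n)%N -> ssrbool.symmetric e -> irreflexive e -> ~ is_complete e ->
  cohen_macaulay (ideal_of (@edge_gens n K e setT)) -> ucycle e c -> ~ (2 < size c)%N.
Proof.
move=> n_ge4 e_sym e_irr ncomp cm cyc szc; have idI := ideal_of_ideal (@edge_gens n K e setT).
have [i [j [ij nij]]] : exists i j, i != j /\ ~~ e i j.
  have [/forallP full|] := boolP [forall i, forall j, (i != j) ==> e i j].
    by case: ncomp => i j ij; have /forallP/(_ j) := full i; rewrite ij.
  rewrite negb_forall => /existsP [i]; rewrite negb_forall => /existsP [j].
  by rewrite negb_imply => /andP[ij nij]; exists i, j.
have chain : prime_chain (ideal_of (@edge_gens n K e setT)) (n - 2).
  apply: (@prime_chain_vars _ _ _ [set i; j]); first by rewrite cards2 ij; lia.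
  by move=> f; apply: edge_ideal_kill; apply: nonedge_cover.
have [fs rfs szfs] := cohen_macaulay_regular_seq cm chain.
have := koszul_class_regular_seq idI
  (cycle_koszul_class idI (@edge_ideal_edge n K e) (@edge_ideal_order n K e e_irr) cyc szc) rfs.
lia.
Qed.

Theorem corollary3p5 (n : nat) (K : fieldType) (e : rel 'I_n)
    (n_ge4 : (4 <= n)%N)
    (e_sym : ssrbool.symmetric e) (e_irr : irreflexive e)
    (no_isolated : forall i, exists j, e i j) :
  is_level (complementary_edge_ideal K e) <->
  is_complete e \/ is_tree e \/ is_disjoint_union_of_edges e.
Proof.
have -> : complementary_edge_ideal K e = ideal_of (@edge_gens n K e setT).
  apply: functional_extensionality => f; apply: propositional_extensionality.
  exact: complementary_edge_idealE.
split.
  move=> lev; case: (Classical_Prop.classic (is_complete e)) => [|ncomp]; first by left.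
  have acyc c : ucycle e c -> ~ (2 < size c)%N.
    exact: (level_acyclic n_ge4 e_sym e_irr ncomp lev.1).
  right.
  have nfd := level_forest e_sym e_irr no_isolated n_ge4 acyc lev.
  case: (Classical_Prop.classic (disconnected e setT)) => dc; [right | left; split=> // i j].
    move=> i; have [j eij] := no_isolated i; exists j => // k.
    have nofork w x y : e w x -> e w y -> x = y.
      move=> ewx ewy; apply/eqP; apply: contraT => xy; case: nfd; split=> //.
      by exists w, x, y; rewrite !inE ewx ewy.
    apply/idP/idP; last first.
      by rewrite !inE => /orP[]/eqP ->; [apply: connect0 | apply: connect1].
    move=> cik; suff : k \in [set i; j] by rewrite !inE.
    apply: (closed_connect _ _ cik); last by rewrite !inE eqxx.
    move=> x y; rewrite !inE => /orP[]/eqP ->.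
      by move=> eiy; rewrite (nofork _ _ _ eij eiy) eqxx orbT.
    by move=> ejy; rewrite (nofork j i y) ?eqxx // e_sym.
  by apply: contraT => nc; case: dc; exists i, j; rewrite !inE.
case=> [full|[tr|dj]].
- exact: complete_level.
- apply: forest_level => //; first by case: tr.
  by left; apply: tree_not_disconnected.
- apply: forest_level => //; last by right; apply: disjoint_edges_no_fork.
  case=> [|a [|b [|c s]]] // /andP[cyc U] _.
  have [j _ con] := dj a.
  move: cyc; rewrite (cycle_path a) /= => /and3P[_ eab /andP[ebc _]].
  have cb : connect e a b := connect1 eab.
  have cc : connect e a c := connect_trans cb (connect1 ebc).
  rewrite con !inE in cb; rewrite con !inE in cc.
  move: U; rewrite /= !inE !negb_or -!andbA => /and5P[ab ac _ bc _].
  move: cb cc; rewrite !(eq_sym _ a) (negPf ab) (negPf ac) /= => /eqP bj /eqP cj.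
  by rewrite bj cj eqxx in bc.
Qed.
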